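(* If $\Gamma$ is a circular polygon, then $\mathcal{X}_\lambda^-\cap\mathcal{Y}_\lambda^+\neq\emptyset$ for all $\mathcal{X},\mathcal{Y}\in\{\mathcal{B},\mathcal{O},\mathcal{A}\}$ and $\lambda\in\{0,\pi\}$.
   Context: **Circular polygons.** A circular $k$-gon is a simple closed strictly convex curve $\Gamma\subset\mathbb{R}^2\simeq\mathbb{C}$ formed by the concatenation of $k>1$ circular arcs $\Gamma_1,\dots,\Gamma_k$ (listed counter-clockwise, index modulo $k$) that is $C^1$ but not $C^2$ at the intersection point (node) of any two consecutive arcs; so consecutive arcs have different radii, and circles are excluded. A circular polygon is a circular $k$-gon for some $k$. The arc $\Gamma_j$ has center $O_j$, radius $r_j>0$ and angular range $[a_j,b_j]$, with $b_j=a_{j+1}$ and $a_1<b_1=a_2<\cdots<b_k=a_1+2\pi$. The polar parametrisation is $z:\mathbb{T}=\mathbb{R}/2\pi\mathbb{Z}\to\Gamma$, $z(\varphi)=O_j+r_je^{i\varphi}$ for $\varphi\in[a_j,b_j]$. **Billiard map.** $\mathcal{M}=\mathbb{T}\times[0,\pi]$. For $0<\theta<\pi$, the line through $z(\varphi)$ in the direction $v$ obtained by rotating $z'(\varphi)$ counter-clockwise by $\theta$ meets $\Gamma$ at exactly one other point $z(\bar\varphi)$; $\bar\theta\in(0,\pi)$ is the counter-clockwise angle from $v$ to $z'(\bar\varphi)$, and $f(\varphi,\theta)=(\bar\varphi,\bar\theta)$. This is a homeomorphism of $\mathbb{T}\times(0,\pi)$. **Sliding trajectories.** Let $(\varphi_n,\theta_n)=f^n(\varphi,\theta)$,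 $0<\theta<\pi$, $z_n=z(\varphi_n)$. The trajectory is counter-clockwise sliding (forward: for all $n\ge0$; backward: for all $n\le-1$) when the consecutive impact points $z_n,z_{n+1}$ are either in the same arc or in consecutive arcs $\Gamma_j,\Gamma_{j+1}$ in the counter-clockwise direction. Clockwise sliding is defined analogously with the clockwise direction. **Final sliding motions.** Forward counter-clockwise sliding trajectories (identified with their initial conditions) are classified as: $\mathcal{B}_0^+$ (bounded) if $\inf_{n\ge0}\theta_n>0$; $\mathcal{O}_0^+$ (oscillatory) if $0=\liminf_{n\to+\infty}\theta_n<\limsup_{n\to+\infty}\theta_n$; $\mathcal{A}_0^+$ (asymptotic) if $\lim_{n\to+\infty}\theta_n=0$. The classes $\mathcal{B}_0^-,\mathcal{O}_0^-,\mathcal{A}_0^-$ are defined in the same way for backward counter-clockwise sliding trajectories, with $n\le-1$ and $n\to-\infty$. The classes $\mathcal{B}_\pi^\pm,\mathcal{O}_\pi^\pm,\mathcal{A}_\pi^\pm$ are defined in the same way for clockwise sliding trajectories, replacing $\theta_n$ by $|\theta_n-\pi|$. *)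

(* Defs.v *)
(* Stdlib reals with Coquelicot; the plane is Coquelicot's [C]. *)
From Stdlib Require Export Reals ZArith.
From Coquelicot Require Export Coquelicot.

Open Scope R_scope.

Definition cis (t : R) : C := (cos t, sin t).

(** * Plane curves, given by a parametrisation [z : R -> C] *)

Definition curve (z : R -> C) (p : C) : Prop := exists phi : R, p = z phi.

Definition simple_closed (z : R -> C) : Prop :=
  (forall phi : R, continuous z phi) /\
  (forall phi : R, z (phi + 2 * PI) = z phi) /\
  (forall phi psi : R, z phi = z psi ->
     exists m : Z, psi = phi + 2 * PI * IZR m).

Definition strictly_convex_body (K : C -> Prop) : Prop :=
  (closed K /\ exists M : R, forall p : C, K p -> Cmod p <= M) /\
  (forall p q : C, K p -> K q -> p <> q ->
     forall t : R, 0 < t < 1 ->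
     locally ((RtoC (1 - t) * p + RtoC t * q)%C) K).

(* The curve is the boundary of a compact strictly convex set; [K] being
   closed, its boundary consists of its non-interior points. *)
Definition strictly_convex_curve (z : R -> C) : Prop :=
  exists K : C -> Prop, strictly_convex_body K /\
    forall p : C, curve z p <-> K p /\ ~ locally p K.

(* Regularity of the geometric curve, not of [z] itself: near [z phi0] the
   curve has a regular parametrisation [z o h] of class [C^m] ([1 <= m]), whose
   i-th derivative is [w i].  The polar parametrisation used below is not
   differentiable at the nodes, since [|z'|] jumps from one radius to the
   next. *)
Definition smooth_at (m : nat) (z : R -> C) (phi0 : R) : Prop :=
  exists (e : R) (h : R -> R) (w : nat -> R -> C),
    0 < e /\ h 0 = phi0 /\
    (forall t : R, Rabs t < e -> continuous h t) /\
    (forall s t : R, Rabs s < e -> Rabs t < e -> s < t -> h s < h t) /\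
    (forall t : R, Rabs t < e -> w 0%nat t = z (h t)) /\
    (forall (i : nat) (t : R), (i < m)%nat -> Rabs t < e ->
       @is_derive R_AbsRing C_R_NormedModule (w i) t (w (S i) t)) /\
    (forall t : R, Rabs t < e -> continuous (w m) t) /\
    (forall t : R, Rabs t < e -> w 1%nat t <> RtoC 0).

(** * Circular polygons *)

(* Indices modulo [nsides] are integers, with periodic centers and radii; the
   angular range of the [j]-th arc is [[start j, start (j + 1)]].  The function
   [z] is the polar parametrisation, as a [2 PI]-periodic function on [R]: it
   is determined by [polar], whose overlapping cases at the angles [start j]
   say that consecutive arcs share an endpoint. *)
Record circular_polygon : Type := {
  nsides : Z;
  center : Z -> C;
  radius : Z -> R;
  start : Z -> R;
  z : R -> C;
  nsides_gt1 : (1 < nsides)%Z;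
  center_mod : forall j : Z, center (j + nsides) = center j;
  radius_mod : forall j : Z, radius (j + nsides) = radius j;
  start_mod : forall j : Z, start (j + nsides) = start j + 2 * PI;
  radius_pos : forall j : Z, 0 < radius j;
  start_incr : forall j : Z, start j < start (j + 1);
  polar : forall (j : Z) (phi : R), start j <= phi <= start (j + 1) ->
    z phi = (center j + RtoC (radius j) * cis phi)%C;
  z_simple_closed : simple_closed z;
  z_strictly_convex : strictly_convex_curve z;
  node_C1 : forall j : Z, smooth_at 1 z (start j);
  node_not_C2 : forall j : Z, ~ smooth_at 2 z (start j)
}.

Definition arc (G : circular_polygon) (j : Z) (p : C) : Prop :=
  exists phi : R, start G j <= phi <= start G (j + 1) /\ p = z G phi.

(** * Billiard map *)

(* The direction of [z' phi], also valid at the nodes: on each arc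
   [z' phi = r_j i e^(i phi)]. *)
Definition tangent (phi : R) : C := (Ci * cis phi)%C.

(* [R / 2 PI Z] is represented by [[0, 2 PI)]. *)
Definition phase_point (x : R * R) : Prop :=
  0 <= fst x < 2 * PI /\ 0 < snd x < PI.

(* The graph of the map on [R / 2 PI Z x (0, PI)]: [y] is the image of [x]. *)
Definition billiard (G : circular_polygon) (x y : R * R) : Prop :=
  let (phi, theta) := x in
  let (phi', theta') := y in
  let v := (cis theta * tangent phi)%C in
  phase_point x /\ phase_point y /\
  z G phi' <> z G phi /\
  (exists t : R, z G phi' = (z G phi + RtoC t * v)%C) /\
  tangent phi' = (cis theta' * v)%C.

(* [s n] is the [n]-th iterate of [x], for all [n] in [Z]. *)
Definition trajectory (G : circular_polygon) (x : R * R) (s : Z -> R * R) :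
    Prop :=
  s 0%Z = x /\ forall n : Z, billiard G (s n) (s (n + 1)%Z).

(** * Final sliding motions *)

Inductive end_angle : Type := lam_0 | lam_pi.

Inductive final_motion : Type := Bounded | Oscillatory | Asymptotic.

(* Counter-clockwise sliding is attached to [0], clockwise sliding to [PI]. *)
Definition sliding_step (G : circular_polygon) (l : end_angle) (p q : C) :
    Prop :=
  exists j : Z, arc G j p /\
    (arc G j q \/
     match l with
     | lam_0 => arc G (j + 1) q
     | lam_pi => arc G (j - 1) q
     end).

Definition angle_gap (l : end_angle) (theta : R) : R :=
  match l with
  | lam_0 => theta
  | lam_pi => Rabs (theta - PI)
  end.

Definition has_motion (X : final_motion) (u : nat -> R) : Prop :=
  match X with
  | Bounded => Rbar_lt 0 (Inf_seq (fun n => Finite (u n)))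
  | Oscillatory => LimInf_seq u = Finite 0 /\ Rbar_lt 0 (LimSup_seq u)
  | Asymptotic => is_lim_seq u 0
  end.

Definition sliding_at (G : circular_polygon) (l : end_angle)
    (s : Z -> R * R) (n : Z) : Prop :=
  sliding_step G l (z G (fst (s n))) (z G (fst (s (n + 1)%Z))).

Definition forward_class (G : circular_polygon) (X : final_motion)
    (l : end_angle) (x : R * R) : Prop :=
  exists s : Z -> R * R, trajectory G x s /\
    (forall n : Z, (0 <= n)%Z -> sliding_at G l s n) /\
    has_motion X (fun m : nat => angle_gap l (snd (s (Z.of_nat m)))).

Definition backward_class (G : circular_polygon) (X : final_motion)
    (l : end_angle) (x : R * R) : Prop :=
  exists s : Z -> R * R, trajectory G x s /\
    (forall n : Z, (n <= -1)%Z -> sliding_at G l s n) /\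
    has_motion X
      (fun m : nat => angle_gap l (snd (s (-1 - Z.of_nat m)%Z))).

(* Main.v *)
Require Import Defs.
From Stdlib Require Import Lra Lia Psatz ClassicalEpsilon FunctionalExtensionality.

(** A chord leaving an arc of radius [r] at angle [t], with polar parameter [x]
    before the node, meets the next arc, of radius [r'], at the angle [t'] given
    by the exact relation [cos t' = (1 - k) cos (x - t) + k cos t], [k = r / r'].
    Thus [t' = t] when the chord starts or ends at the node, while
    [1 - cos t' = k (1 - cos t)] when [x = t]: according to where the impact falls,
    [t' / t] takes any value between [1] and about [mu = sqrt k].  A path of
    initial conditions along which the number of impacts in one arc increases by
    one is therefore stretched, in the next arc, over every impact number [m']
    between about [m d' / d] and [m d' / (mu d)], where [d] and [d'] are the lengths
    of the angular ranges.  Nested intervals and compactness realise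
    every bi-infinite sequence of impact numbers whose consecutive terms are in
    range.  Since the product of the [mu]'s over a turn is [1] while no [mu] is [1],
    the numbers [m_j] close to [E lam^(L j) d_j r_j^(1/4)] are in range for every
    1-Lipschitz [L], provided [lam > 1] is close to [1] and [E] is large; along this
    trajectory the angles are comparable to [lam^(- L j)], and [L] prescribes
    the two final motions.  Reversing time exchanges the two directions of
    sliding. *)

(** * Real analysis *)

(** The point is the supremum of those [t] such that [f] is nonpositive on all of [[a, t]];
    continuity and the signs at the ends exclude a nonzero value there. *)
Lemma first_zero (f : R -> R) (a b : R) :
  a <= b -> (forall t, continuous f t) -> f a <= 0 -> 0 <= f b ->
  exists d, a <= d <= b /\ f d = 0 /\ forall t, a <= t <= d -> f t <= 0.
Proof.
  intros Hab Hc Ha Hb.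
  assert (Hloc : forall t e, 0 < e ->
    exists h, 0 < h /\ forall s, Rabs (s - t) < h -> Rabs (f s - f t) < e).
  { intros t e He.
    destruct (proj1 (filterlim_locally f (f t)) (Hc t) (mkposreal e He))
      as [h Hh].
    exists h; split; [apply cond_pos | intros s Hs; exact (Hh s Hs)]. }
  set (E := fun t => a <= t <= b /\ forall s, a <= s <= t -> f s <= 0).
  destruct (completeness E) as [d [Hub Hlub]].
  - exists b. intros t [Ht _]; lra.
  - exists a. split; [lra | intros s Hs; replace s with a by lra; exact Ha].
  - assert (Had : a <= d).
    { apply Hub. split; [lra | intros s Hs; replace s with a by lra; exact Ha]. }
    assert (Hdb : d <= b) by (apply Hlub; intros t [Ht _]; lra).
    assert (Hlt : forall t, a <= t < d -> f t <= 0).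
    { intros t Ht. destruct (Rle_lt_dec (f t) 0) as [H | H]; [exact H |].
      exfalso. assert (d <= t); [| lra].
      apply Hlub. intros s [Hs Hs0].
      destruct (Rle_lt_dec s t) as [Hst | Hst]; [exact Hst |].
      specialize (Hs0 t); lra. }
    assert (Hd0 : f d <= 0).
    { destruct (Rle_lt_dec (f d) 0) as [H | H]; [exact H |].
      destruct (Hloc d (f d) H) as [h [Hh Hs]].
      destruct (Req_dec a d) as [<- | Hne]; [lra |].
      specialize (Hs (Rmax a (d - h / 2))).
      assert (Hm : a <= Rmax a (d - h / 2) < d /\ d - h / 2 <= Rmax a (d - h / 2))
        by (unfold Rmax; destruct (Rle_dec a (d - h / 2)); lra).
      specialize (Hlt _ (proj1 Hm)).
      assert (Hr : Rabs (Rmax a (d - h / 2) - d) < h) by (apply Rabs_def1; lra).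
      specialize (Hs Hr). apply Rabs_def2 in Hs. lra. }
    exists d. split; [lra |]. split.
    + destruct (Rle_lt_dec 0 (f d)) as [H | H]; [lra |]. exfalso.
      destruct (Hloc d (- f d)) as [h [Hh Hs]]; [lra |].
      assert (Hdb' : d < b) by (destruct (Req_dec d b); [subst; lra | lra]).
      set (t1 := Rmin b (d + h / 2)).
      assert (Hm : d < t1 <= b /\ t1 <= d + h / 2)
        by (unfold t1, Rmin; destruct (Rle_dec b (d + h / 2)); lra).
      assert (t1 <= d); [| lra].
      apply Hub. split; [lra |]. intros s Hs1.
      destruct (Rlt_le_dec s d) as [Hsd | Hsd]; [apply Hlt; lra |].
      assert (Hr : Rabs (s - d) < h) by (apply Rabs_def1; lra).
      specialize (Hs s Hr). apply Rabs_def2 in Hs. lra.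
    + intros t Ht. destruct (Req_dec t d) as [-> | Hne]; [exact Hd0 |].
      apply Hlt; lra.
Qed.

(** Here [d] ends the initial stretch on which [B <= 0]; after reflecting [t] to [- t], the same
    argument run back from [d] yields [c]. With [A] the exit gap and [B] the gap minus twice the
    angle, this cuts an admissible piece out of a path. *)
Lemma crossing_subinterval (A B : R -> R) (a b : R) :
  a <= b -> (forall t, continuous A t) -> (forall t, continuous B t) ->
  (forall t, a <= t <= b -> B t <= A t) -> A a <= 0 -> 0 <= B b ->
  exists c d, a <= c /\ c <= d /\ d <= b /\ A c = 0 /\ B d = 0 /\
    forall t, c <= t <= d -> 0 <= A t /\ B t <= 0.
Proof.
  intros Hab HA HB Hle Ha Hb.
  destruct (first_zero B a b Hab HB) as [d [Hd [Bd HBd]]];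
    [specialize (Hle a); lra | exact Hb |].
  destruct (first_zero (fun t => - A (- t)) (- d) (- a)) as [e [He [Ae HAe]]].
  - lra.
  - intros t. apply (@continuous_opp _ R_AbsRing R_NormedModule (fun t => A (- t))).
    apply (continuous_comp Ropp A); [| apply HA].
    apply (@continuous_opp _ R_AbsRing R_NormedModule (fun t => t)), continuous_id.
  - rewrite Ropp_involutive. specialize (Hle d); lra.
  - rewrite Ropp_involutive. lra.
  - exists (- e), d. repeat split; try lra.
    + specialize (HAe (- t)). rewrite Ropp_involutive in HAe. lra.
    + apply HBd; lra.
Qed.

(* Compare the mean slopes of [sin] on [[0, l a]] and [[l a, a]]. *)
Lemma sin_concave_0 (l a : R) :
  0 <= l <= 1 -> 0 <= a <= PI -> l * sin a <= sin (l * a).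
Proof.
  intros Hl Ha.
  assert (H0 : 0 <= l * a) by nra. assert (H1 : l * a <= a) by nra.
  destruct (Req_dec (l * a) 0) as [E0 | N0].
  { rewrite E0, sin_0. apply Rmult_integral in E0.
    destruct E0 as [-> | ->]; rewrite ?sin_0; lra. }
  destruct (Req_dec (l * a) a) as [E1 | N1].
  { rewrite E1. assert (0 <= sin a) by (apply sin_ge_0; lra). nra. }
  destruct (MVT_cor2 sin cos 0 (l * a)) as [c1 [Hc1 Hc1']];
    [lra | intros; apply derivable_pt_lim_sin |].
  destruct (MVT_cor2 sin cos (l * a) a) as [c2 [Hc2 Hc2']];
    [lra | intros; apply derivable_pt_lim_sin |].
  rewrite sin_0 in Hc1.
  assert (Hcos : cos c2 <= cos c1) by (apply cos_decr_1; lra).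
  assert (0 < a) by lra.
  assert (l * sin a = l * (sin a - sin (l * a)) + l * sin (l * a)) by ring.
  assert (E : sin a - sin (l * a) = cos c2 * ((1 - l) * a)) by (rewrite Hc2; ring).
  assert (E' : sin (l * a) = cos c1 * (l * a)) by lra.
  assert (l * (sin a - sin (l * a)) <= (1 - l) * sin (l * a)); [| lra].
  rewrite E, E'.
  replace (l * (cos c2 * ((1 - l) * a))) with (l * (1 - l) * a * cos c2) by ring.
  replace ((1 - l) * (cos c1 * (l * a))) with (l * (1 - l) * a * cos c1) by ring.
  apply Rmult_le_compat_l; [| exact Hcos].
  apply Rmult_le_pos; [apply Rmult_le_pos |]; lra.
Qed.

Lemma one_minus_cos (t : R) : 1 - cos t = 2 * (sin (t / 2))².
Proof.
  replace t with (2 * (t / 2)) at 1 by field. rewrite cos_2a_sin.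
  unfold Rsqr. ring.
Qed.

Lemma one_minus_cos_scal (l a : R) :
  0 <= l <= 1 -> 0 <= a <= PI -> l² * (1 - cos a) <= 1 - cos (l * a).
Proof.
  intros Hl Ha. rewrite !one_minus_cos.
  replace (l * a / 2) with (l * (a / 2)) by field.
  assert (Hs := sin_concave_0 l (a / 2) Hl ltac:(lra)).
  assert (0 <= sin (a / 2)) by (apply sin_ge_0; lra).
  assert ((l * sin (a / 2))² <= (sin (l * (a / 2)))²)
    by (apply Rsqr_incr_1; [exact Hs | nra | nra]).
  rewrite Rsqr_mult in H0. lra.
Qed.

(** Cosine decreases on [[0, PI]], so the lower bound on [1 - cos (l * a)] decides. This turns the
    exact relation at a node into a comparison of angles. *)
Lemma angle_le_scal (l a b : R) :
  0 <= l <= 1 -> 0 <= a <= PI -> 0 <= b <= PI ->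
  1 - cos b = l² * (1 - cos a) -> b <= l * a.
Proof.
  intros Hl Ha Hb E.
  destruct (Rle_lt_dec b (l * a)) as [H | H]; [exact H |]. exfalso.
  assert (0 <= l * a) by nra.
  assert (cos b < cos (l * a)) by (apply cos_decreasing_1; lra).
  assert (Hs := one_minus_cos_scal l a Hl Ha). lra.
Qed.

Lemma one_minus_cos_le (t : R) : 1 - cos t <= t² / 2.
Proof.
  rewrite one_minus_cos.
  assert (H : (sin (t / 2))² <= (t / 2)²).
  { apply Rsqr_le_abs_1.
    assert (H0 : forall u, 0 <= u -> Rabs (sin u) <= u).
    { intros u [Hu | <-]; [| rewrite sin_0, Rabs_R0; lra].
      assert (S1 := SIN_bound u).
      destruct (Rle_lt_dec u PI) as [Hp | Hp].
      - rewrite Rabs_pos_eq; [apply Rlt_le, sin_lt_x, Hu | apply sin_ge_0; lra].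
      - assert (P := PI2_1). apply Rabs_le. lra. }
    destruct (Rle_lt_dec 0 (t / 2)) as [Hp | Hp].
    - rewrite (Rabs_pos_eq (t / 2) Hp). exact (H0 _ Hp).
    - rewrite <- Rabs_Ropp, <- sin_neg, (Rabs_left (t / 2) Hp). apply H0. lra. }
  unfold Rsqr in *. lra.
Qed.

(* The arc cosine on [0, 1], extended by constants so as to be continuous on the
   whole line: paths can then be composed without domain conditions. *)
Definition angle_of_cos (c : R) : R :=
  let c' := Rmax 0 (Rmin 1 c) in 2 * atan (sqrt ((1 - c') / (1 + c'))).

Lemma angle_of_cos_bounds (c : R) : 0 <= angle_of_cos c <= PI / 2.
Proof.
  unfold angle_of_cos. set (c' := Rmax 0 (Rmin 1 c)).
  assert (Hc : 0 <= c' <= 1).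
  { unfold c', Rmax, Rmin. destruct (Rle_dec 1 c), (Rle_dec 0 _); lra. }
  assert (Hu : 0 <= (1 - c') / (1 + c') <= 1).
  { split; [apply Rdiv_le_0_compat; lra |].
    apply (Rmult_le_reg_r (1 + c')); [lra |].
    unfold Rdiv. rewrite Rmult_assoc, Rinv_l; lra. }
  assert (Hs : 0 <= sqrt ((1 - c') / (1 + c')) <= 1).
  { split; [apply sqrt_pos |]. rewrite <- sqrt_1 at 3. apply sqrt_le_1_alt, Hu. }
  assert (forall u v, u <= v -> atan u <= atan v) as Hm.
  { intros u v [H | ->]; [left; apply atan_increasing, H | lra]. }
  assert (H1 := Hm _ _ (proj1 Hs)). assert (H2 := Hm _ _ (proj2 Hs)).
  rewrite atan_0 in H1. rewrite atan_1 in H2. lra.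
Qed.

Lemma cos_angle_of_cos (c : R) : 0 <= c <= 1 -> cos (angle_of_cos c) = c.
Proof.
  intros Hc. unfold angle_of_cos.
  rewrite Rmin_right, Rmax_right by lra.
  set (u := sqrt ((1 - c) / (1 + c))).
  assert (Hu : u² = (1 - c) / (1 + c)).
  { unfold u. apply Rsqr_sqrt, Rdiv_le_0_compat; lra. }
  rewrite cos_2a_cos, cos_atan, Hu.
  replace (1 + (1 - c) / (1 + c)) with (2 / (1 + c)) by (field; lra).
  assert (0 < 2 / (1 + c)) by (apply Rdiv_lt_0_compat; lra).
  assert (Hsq : sqrt (2 / (1 + c)) * sqrt (2 / (1 + c)) = 2 / (1 + c))
    by (apply sqrt_sqrt; lra).
  assert (0 < sqrt (2 / (1 + c))) by (apply sqrt_lt_R0; lra).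
  replace (2 * (1 / sqrt (2 / (1 + c))) * (1 / sqrt (2 / (1 + c))))
    with (2 / (sqrt (2 / (1 + c)) * sqrt (2 / (1 + c)))) by (field; lra).
  rewrite Hsq. field; lra.
Qed.

Lemma angle_of_cos_cos (t : R) : 0 <= t <= PI / 2 -> angle_of_cos (cos t) = t.
Proof.
  intros Ht. assert (Hb := angle_of_cos_bounds (cos t)).
  assert (P := PI_RGT_0).
  assert (0 <= cos t) by (apply cos_ge_0; lra).
  assert (cos t <= 1) by apply COS_bound.
  assert (E := cos_angle_of_cos (cos t) ltac:(lra)).
  apply cos_inj in E; lra.
Qed.

Lemma continuous_Rmax_Rmin_01 (c : R) : continuous (fun c => Rmax 0 (Rmin 1 c)) c.
Proof.
  apply filterlim_locally. intros e. exists e. intros d Hd.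
  unfold ball in *; simpl in *; unfold AbsRing_ball, abs, minus, plus, opp in *;
    simpl in *.
  apply Rabs_def2 in Hd. apply Rabs_def1;
  unfold Rmax, Rmin; destruct (Rle_dec 1 d), (Rle_dec 1 c);
    repeat destruct (Rle_dec 0 _); lra.
Qed.

Lemma continuous_angle_of_cos (c : R) : continuous angle_of_cos c.
Proof.
  unfold angle_of_cos.
  apply (continuous_comp (fun c => Rmax 0 (Rmin 1 c))
    (fun c' => 2 * atan (sqrt ((1 - c') / (1 + c'))))).
  { apply continuous_Rmax_Rmin_01. }
  assert (Hc : 0 <= Rmax 0 (Rmin 1 c)) by apply Rmax_l.
  revert Hc. generalize (Rmax 0 (Rmin 1 c)). intros c' Hc.
  apply (continuous_scal_r 2 (fun c' => atan (sqrt ((1 - c') / (1 + c'))))).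
  apply continuous_atan_comp, continuous_sqrt_comp.
  apply (@ex_derive_continuous R_AbsRing R_NormedModule).
  auto_derive. lra.
Qed.

(** * Stretching of paths at the nodes *)

(* On entering an arc of angular length [d], the state is [(y, t)]: [y] is the polar
   parameter past the node, [t] the angle of reflection.  The impacts in the arc
   are at [y + 2 i t], [i < m], and [exit_gap] is what remains after the last
   one; the count [m] is a real number until [sliding_trajectory]. *)
Definition exit_gap (d m : R) (p : R * R) : R := d - fst p - 2 * (m - 1) * snd p.

Definition admissible (d m : R) (p : R * R) : Prop :=
  0 <= fst p <= 2 * snd p /\ 0 <= exit_gap d m p <= 2 * snd p.

(** With [mu²] the ratio of the two radii, this is the cosine of the angle after the node. *)
Definition exit_cos (d m mu : R) (p : R * R) : R :=
  (1 - mu²) * cos (exit_gap d m p - snd p) + mu² * cos (snd p).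

(** The first equation says that a chord spans, in polar parameter, the sum of its two angles:
    [x + y = t + t'], with [x] the exit gap and [y] the parameter past the node. *)
Definition linked (d m mu : R) (p q : R * R) : Prop :=
  fst q = snd q + snd p - exit_gap d m p /\
  cos (snd q) = exit_cos d m mu p.

Definition node_map (d m mu : R) (p : R * R) : R * R :=
  let t := angle_of_cos (exit_cos d m mu p) in
  (t + snd p - exit_gap d m p, t).

(** The last two inequalities force [t <= 1] and [mu t <= 1] on admissible states, so that the
    angles on both sides of a node stay in [[0, PI / 2]]. *)
Definition small_angles (d m mu : R) : Prop :=
  0 < d /\ 0 < mu /\ 2 <= m /\ d <= 2 * (m - 1) /\ mu * d <= 2 * (m - 1).

(* The impact numbers reached from [m], with explicit error terms: [m'] lies
   between [m d' / d] and [m d' / (mu d)]. *)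
Definition jump (d m mu d' m' : R) : Prop :=
  mu <= 1 /\ (m + 1) * d' <= m' * d /\
    (2 * m' + 1) * (mu * d) <= 2 * (m - 1) * d' \/
  1 <= mu /\ m' * d <= (m - 1) * d' /\
    2 * (m + 1) * d' <= (2 * m' - 1) * (mu * d).

(** The arc splits as [d = y + 2 (m - 1) t + x] with [x] and [y] in [[0, 2 t]]. *)
Lemma admissible_angle (d m mu : R) (p : R * R) :
  small_angles d m mu -> admissible d m p ->
  0 < snd p <= 1 /\ mu * snd p <= 1 /\
  2 * (m - 1) * snd p <= d <= 2 * (m + 1) * snd p.
Proof.
  unfold small_angles, admissible, exit_gap.
  intros (Hd & Hmu & Hm & H1 & H2) (Hy & Hx).
  assert (A : 2 * (m - 1) * snd p <= d <= 2 * (m + 1) * snd p) by lra.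
  assert (0 < snd p) by nra.
  split; [split; [lra | nra] |]. split; [nra | exact A].
Qed.

(** Since [|x - t| <= t], one has [cos t <= cos (x - t)], whence the upper bounds. For [mu <= 1] the
    value is a mean of two nonnegative cosines; for [mu > 1] it is at least [1 - mu² (1 - cos t)],
    nonnegative because [mu t <= 1]. *)
Lemma exit_cos_bounds (d m mu : R) (p : R * R) :
  small_angles d m mu -> admissible d m p ->
  0 <= exit_cos d m mu p <= 1 /\
  exit_cos d m mu p <= cos (exit_gap d m p - snd p).
Proof.
  intros Hs Ha. destruct (admissible_angle _ _ _ _ Hs Ha) as (Ht & Hmt & _).
  destruct Ha as [_ Hx]. assert (P := PI2_1). destruct Hs as (_ & Hmu & _).
  unfold exit_cos. set (x := exit_gap d m p) in *. set (t := snd p) in *.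
  assert (Hc : cos t <= cos (x - t)).
  { destruct (Rle_lt_dec 0 (x - t)).
    - apply cos_decr_1; lra.
    - rewrite <- (cos_neg (x - t)). apply cos_decr_1; lra. }
  assert (0 <= cos t) by (apply cos_ge_0; lra).
  assert (cos (x - t) <= 1) by apply COS_bound.
  assert (Hq := one_minus_cos_le t).
  assert (0 < mu²) by (apply Rsqr_pos_lt; lra).
  assert (mu² * t² <= 1).
  { rewrite <- Rsqr_mult. rewrite <- Rsqr_1. apply Rsqr_incr_1; nra. }
  assert (mu² * (1 - cos t) <= 1) by nra.
  assert (mu² * (cos (x - t) - cos t) <= mu² * (1 - cos t))
    by (apply Rmult_le_compat_l; lra).
  split; [| nra].
  split; [| nra].
  destruct (Rle_lt_dec mu² 1); nra.
Qed.

(** The entry condition on [y = t' + t - x] amounts to [|x - t| <= t'], which follows from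
    [cos t' <= cos (x - t)]. *)
Lemma node_map_spec (d m mu : R) (p : R * R) :
  small_angles d m mu -> admissible d m p ->
  let q := node_map d m mu p in
  linked d m mu p q /\ 0 <= fst q <= 2 * snd q /\ 0 <= snd q <= PI / 2.
Proof.
  intros Hs Ha q. assert (Hc := exit_cos_bounds _ _ _ _ Hs Ha).
  assert (Hb := angle_of_cos_bounds (exit_cos d m mu p)).
  assert (E := cos_angle_of_cos _ (proj1 Hc)).
  destruct (admissible_angle _ _ _ _ Hs Ha) as (Ht & Hmt & _).
  destruct Ha as [_ Hx]. assert (P := PI2_1).
  unfold q, node_map, linked in *; simpl. split; [split; [reflexivity | exact E] |].
  split; [| exact Hb].
  set (t' := angle_of_cos (exit_cos d m mu p)) in *.
  set (x := exit_gap d m p) in *. set (t := snd p) in *.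
  assert (Hcc : cos t' <= cos (x - t)) by lra.
  assert (Habs : Rabs (x - t) <= t').
  { apply cos_decr_0; try lra.
    - apply Rabs_pos.
    - apply Rabs_le; lra.
    - unfold Rabs; destruct (Rcase_abs (x - t)); rewrite ?cos_neg; exact Hcc. }
  apply Rabs_le_between in Habs. lra.
Qed.

Lemma node_map_at_ends (d m mu : R) (p : R * R) :
  small_angles d m mu -> admissible d m p ->
  exit_gap d m p = 0 \/ exit_gap d m p = 2 * snd p ->
  snd (node_map d m mu p) = snd p.
Proof.
  intros Hs Ha He. destruct (admissible_angle _ _ _ _ Hs Ha) as (Ht & _).
  assert (P := PI2_1).
  assert (E : exit_cos d m mu p = cos (snd p)).
  { unfold exit_cos. destruct He as [-> | ->].
    - rewrite Rminus_0_l, cos_neg. ring.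
    - replace (2 * snd p - snd p) with (snd p) by ring. ring. }
  simpl. rewrite E. apply angle_of_cos_cos. lra.
Qed.

Lemma node_map_at_middle (d m mu : R) (p : R * R) :
  small_angles d m mu -> admissible d m p -> exit_gap d m p = snd p ->
  (mu <= 1 -> snd (node_map d m mu p) <= mu * snd p) /\
  (1 <= mu -> mu * snd p <= snd (node_map d m mu p)).
Proof.
  intros Hs Ha He. destruct (admissible_angle _ _ _ _ Hs Ha) as (Ht & _).
  destruct (node_map_spec _ _ _ _ Hs Ha) as ([_ E] & _ & Hb).
  assert (Hmu : 0 < mu) by apply Hs.
  assert (P := PI2_1).
  unfold exit_cos in E. rewrite He, Rminus_diag, cos_0 in E.
  set (t' := snd (node_map d m mu p)) in *. set (t := snd p) in *.
  split; intros H.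
  - apply angle_le_scal; lra.
  (* For [mu >= 1] the comparison is used with the factor [/ mu] and the two angles exchanged. *)
  - assert (t <= / mu * t').
    { apply angle_le_scal; try lra.
      - split; [apply Rlt_le, Rinv_0_lt_compat, Hmu |].
        rewrite <- Rinv_1. apply Rinv_le_contravar; lra.
      - rewrite E, Rsqr_inv'. field. unfold Rsqr. nra. }
    apply (Rmult_le_reg_l (/ mu)); [apply Rinv_0_lt_compat, Hmu |].
    rewrite <- Rmult_assoc, Rinv_l, Rmult_1_l by lra. assumption.
Qed.

Definition continuous_path (p : R -> R * R) : Prop :=
  (forall t, continuous (fun t => fst (p t)) t) /\
  (forall t, continuous (fun t => snd (p t)) t).

Lemma continuous_affine (f g : R -> R) (a b c t : R) :
  continuous f t -> continuous g t ->
  continuous (fun t => a + b * f t + c * g t) t.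
Proof.
  intros Hf Hg.
  apply (continuous_plus (fun t => a + b * f t) (fun t => c * g t)).
  - apply (continuous_plus (fun t => a) (fun t => b * f t)).
    + apply continuous_const.
    + apply (continuous_scal_r b f), Hf.
  - apply (continuous_scal_r c g), Hg.
Qed.

Lemma continuous_ext_fun (f g : R -> R) (t : R) :
  (forall s, f s = g s) -> continuous f t -> continuous g t.
Proof. intros H. apply continuous_ext, H. Qed.

Lemma continuous_exit_gap (d m : R) (p : R -> R * R) (t : R) :
  continuous_path p -> continuous (fun t => exit_gap d m (p t)) t.
Proof.
  intros [H1 H2].
  apply continuous_ext_fun with
    (fun t => d + (-1) * fst (p t) + (- 2 * (m - 1)) * snd (p t)).
  - intros s; unfold exit_gap; ring.
  - apply continuous_affine; auto.
Qed.

Lemma continuous_node_map (d m mu : R) (p : R -> R * R) :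
  continuous_path p -> continuous_path (fun t => node_map d m mu (p t)).
Proof.
  intros Hp. assert (H2 := proj2 Hp).
  assert (Hx := fun t => continuous_exit_gap d m p t Hp).
  assert (Ht : forall t, continuous
    (fun t => angle_of_cos (exit_cos d m mu (p t))) t).
  { intros t. apply (continuous_comp (fun t => exit_cos d m mu (p t)) angle_of_cos);
      [| apply continuous_angle_of_cos].
    unfold exit_cos.
    apply continuous_ext_fun with (fun t => 0 + (1 - mu²) * cos
      (0 + 1 * exit_gap d m (p t) + (-1) * snd (p t)) + mu² * cos (snd (p t))).
    - intros s. rewrite Rplus_0_l. do 3 f_equal. ring.
    - apply continuous_affine; apply continuous_cos_comp;
        [apply continuous_affine; auto | auto]. }
  split; [| exact Ht]. intros t. simpl.
  apply continuous_ext_fun with (fun t => 0 + 1 *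
    (0 + 1 * angle_of_cos (exit_cos d m mu (p t)) + 1 * snd (p t))
     + (-1) * exit_gap d m (p t)).
  - intros s. ring.
  - apply continuous_affine; auto. apply continuous_affine; auto.
Qed.

(* At the left end of the path the last impact is at the next node; at the right
   end the next impact would be. *)
Definition stretched (d m : R) (p : R -> R * R) (a b : R) : Prop :=
  a <= b /\ (forall t, a <= t <= b -> admissible d m (p t)) /\
  exit_gap d m (p a) = 0 /\ exit_gap d m (p b) = 2 * snd (p b).

(** At both ends of the path the node keeps the angle, while at an intermediate [c] it scales the
    angle by [mu] or more extremely. Hence on one of the halves [[a, c]] and [[c, b]] the exit gap
    of the next arc goes from at most [0] to at least [2 t'], and a piece of that half is stretched
    again. *)
Lemma stretched_step (d m mu d' m' : R) (p : R -> R * R) (a b : R) :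
  continuous_path p -> small_angles d m mu -> 1 <= m' ->
  jump d m mu d' m' -> stretched d m p a b ->
  exists a' b', a <= a' /\ b' <= b /\
    stretched d' m' (fun t => node_map d m mu (p t)) a' b'.
Proof.
  intros Hp Hs Hm' Hj (Hab & Hadm & Ha & Hb).
  set (q := fun t => node_map d m mu (p t)).
  assert (Hq : continuous_path q) by apply (continuous_node_map d m mu p Hp).
  assert (Hspec := fun t Ht => node_map_spec _ _ _ _ Hs (Hadm t Ht)).
  assert (Hang := fun t Ht => admissible_angle _ _ _ _ Hs (Hadm t Ht)).
  assert (Hsub : forall a0 b0, a <= a0 -> a0 <= b0 -> b0 <= b ->
    exit_gap d' m' (q a0) <= 0 ->
    0 <= exit_gap d' m' (q b0) - 2 * snd (q b0) ->
    exists a' b', a <= a' /\ b' <= b /\ stretched d' m' q a' b').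
  { intros a0 b0 H0 H1 H2 HA HB.
    destruct (crossing_subinterval (fun t => exit_gap d' m' (q t))
      (fun t => 0 + 1 * exit_gap d' m' (q t) + (-2) * snd (q t)) a0 b0 H1)
      as (a' & b' & K1 & K2 & K3 & K4 & K5 & K6); try lra.
    - intros t. apply continuous_exit_gap, Hq.
    - intros t. apply continuous_affine;
        [apply continuous_exit_gap, Hq | apply Hq].
    - intros t Ht. destruct (Hspec t ltac:(lra)) as (_ & _ & ?).
      fold (q t) in *. lra.
    - exists a', b'. split; [lra | split; [lra |]].
      split; [exact K2 | split; [| split; [exact K4 | lra]]].
      intros t Ht. split; [apply (Hspec t); lra |].
      specialize (K6 t Ht). lra. }
  (* The exit gap minus the angle goes from [- t] to [t]; at its zero [c] the node multiplies
     [1 - cos t] by [mu²]. *)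
  destruct (IVT_gen_consistent
    (fun t => 0 + 1 * exit_gap d m (p t) + (-1) * snd (p t)) a b 0)
    as (c & Hc & Ec).
  { intros t. apply continuous_affine;
      [apply continuous_exit_gap, Hp | apply Hp]. }
  { rewrite Ha, Hb. destruct (Hang a ltac:(lra)) as (? & _).
    destruct (Hang b ltac:(lra)) as (? & _).
    rewrite Rmin_left, Rmax_right; lra. }
  rewrite Rmin_left, Rmax_right in Hc by lra.
  assert (Hmid := node_map_at_middle _ _ _ _ Hs (Hadm c Hc) ltac:(lra)).
  assert (Hfq : forall t, fst (q t) = snd (q t) + snd (p t) - exit_gap d m (p t))
    by reflexivity.
  destruct (Hang c Hc) as (Htc & _ & Htc').
  assert (Hs' := Hs). destruct Hs' as (Hd & Hmu & Hm & Hs1 & Hs2).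
  destruct Hj as [(Hmu1 & J1 & J2) | (Hmu1 & J1 & J2)].
  (* At [a] the next arc is entered at [y = 2 t] with angle [t], so its exit gap is [d' - 2 m' t];
     at [c] one has [y = t'], and the gap minus [2 t'] is [d' - (2 m' + 1) t']. *)
  - apply (Hsub a c); try lra.
    + assert (E := node_map_at_ends _ _ _ _ Hs (Hadm a ltac:(lra)) (or_introl Ha)).
      fold (q a) in E. destruct (Hang a ltac:(lra)) as (? & _ & ?).
      unfold exit_gap at 1. rewrite Hfq, Ha, E. nra.
    + destruct Hmid as [Hmid _]. specialize (Hmid Hmu1). fold (q c) in Hmid.
      unfold exit_gap at 1. rewrite Hfq.
      assert ((2 * m' + 1) * snd (q c) <= (2 * m' + 1) * (mu * snd (p c)))
        by (apply Rmult_le_compat_l; lra).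
      assert (0 <= 2 * m' + 1) by lra.
      assert (mu * (2 * (m - 1) * snd (p c)) <= mu * d)
        by (apply Rmult_le_compat_l; lra).
      assert (2 * (m - 1) * ((2 * m' + 1) * (mu * snd (p c))) <= 2 * (m - 1) * d') by nra.
      assert ((2 * m' + 1) * (mu * snd (p c)) <= d')
        by (apply (Rmult_le_reg_l (2 * (m - 1))); lra).
      lra.
  (* At [c] the gap is [d' - (2 m' - 1) t']; at [b] the next arc is entered at [y = 0] with angle
     [t], and the gap minus [2 t] is [d' - 2 m' t]. *)
  - apply (Hsub c b); try lra.
    + destruct Hmid as [_ Hmid]. specialize (Hmid Hmu1). fold (q c) in Hmid.
      unfold exit_gap at 1. rewrite Hfq.
      assert ((2 * m' - 1) * (mu * snd (p c)) <= (2 * m' - 1) * snd (q c))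
        by (apply Rmult_le_compat_l; lra).
      assert (mu * d <= mu * (2 * (m + 1) * snd (p c)))
        by (apply Rmult_le_compat_l; lra).
      assert ((2 * m' - 1) * (mu * d) <=
        (2 * m' - 1) * (mu * (2 * (m + 1) * snd (p c))))
        by (apply Rmult_le_compat_l; lra).
      assert (d' <= (2 * m' - 1) * (mu * snd (p c)))
        by (apply (Rmult_le_reg_l (2 * (m + 1))); lra).
      lra.
    + assert (E := node_map_at_ends _ _ _ _ Hs (Hadm b ltac:(lra)) (or_intror Hb)).
      fold (q b) in E. destruct (Hang b ltac:(lra)) as (? & _ & ?).
      unfold exit_gap at 1. rewrite Hfq, Hb, E.
      assert (2 * (m - 1) * (m' * snd (p b)) <= (m - 1) * d') by nra.
      assert (2 * (m' * snd (p b)) <= d')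
        by (apply (Rmult_le_reg_l (m - 1)); lra).
      lra.
Qed.

(** * Itineraries of finite length *)

Fixpoint orbit (d m mu : nat -> R) (p0 : R * R) (i : nat) : R * R :=
  match i with
  | O => p0
  | S i => node_map (d i) (m i) (mu i) (orbit d m mu p0 i)
  end.

(** The initial path starts at the node, [y = 0], and varies the angle only. Each arc shrinks the
    parameter interval, so the left end of the last one is admissible in all arcs. *)
Lemma finite_itinerary (d m mu : nat -> R) (n : nat) :
  (forall i, small_angles (d i) (m i) (mu i)) ->
  (forall i, jump (d i) (m i) (mu i) (d (S i)) (m (S i))) ->
  exists p : nat -> R * R, forall i, (i <= n)%nat ->
    admissible (d i) (m i) (p i) /\
    linked (d i) (m i) (mu i) (p i) (p (S i)).
Proof.
  intros Hs Hj.
  (* The parameter is minus the angle, so that the first exit gap increases along the path. *)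
  set (path := fun i t => orbit d m mu (0, - t) i).
  assert (Hc : forall i, continuous_path (path i)).
  { induction i as [| i IH].
    - split; intros t; simpl.
      + apply continuous_const.
      + apply (@continuous_opp _ R_AbsRing R_NormedModule (fun t => t)), continuous_id.
    - apply (continuous_node_map (d i) (m i) (mu i) (path i) IH). }
  assert (H : exists a b, stretched (d n) (m n) (path n) a b /\
    forall i t, (i <= n)%nat -> a <= t <= b -> admissible (d i) (m i) (path i t)).
  { induction n as [| n (a & b & Hst & Hadm)].
    - destruct (Hs 0%nat) as (Hd & _ & Hm & _).
      (* At the angle [d / (2 (m - 1))] the last impact is on the next node; at [d / (2 m)] the one
         after it would be. *)
      set (a := - (d 0%nat / (2 * (m 0%nat - 1)))).
      set (b := - (d 0%nat / (2 * m 0%nat))).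
      assert (Ea : 2 * (m 0%nat - 1) * a = - d 0%nat) by (unfold a; field; lra).
      assert (Eb : 2 * m 0%nat * b = - d 0%nat) by (unfold b; field; lra).
      assert (Hab : a <= b).
      { apply (Rmult_le_reg_l (2 * m 0%nat * (m 0%nat - 1))); nra. }
      assert (Hb0 : b < 0) by nra.
      assert (Hst : stretched (d 0%nat) (m 0%nat) (path 0%nat) a b).
      { unfold stretched, admissible, exit_gap, path; simpl.
        split; [exact Hab |]. split; [| lra].
        intros t Ht. split; [lra |]. split; nra. }
      exists a, b. split; [exact Hst |]. intros i t Hi.
      replace i with 0%nat by lia. apply Hst.
    - destruct (stretched_step _ _ _ _ (m (S n)) _ _ _ (Hc n) (Hs n)
        ltac:(destruct (Hs (S n)) as (_ & _ & ? & _); lra) (Hj n) Hst)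
        as (a' & b' & H1 & H2 & Hst').
      exists a', b'. split; [exact Hst' |]. intros i t Hi Ht.
      destruct (Nat.eq_dec i (S n)) as [-> | Hne].
      + apply Hst', Ht.
      + apply Hadm; [lia | lra]. }
  destruct H as (a & b & [Hab _] & Hadm).
  exists (fun i => path i a). intros i Hi.
  assert (A : admissible (d i) (m i) (path i a)) by (apply Hadm; [exact Hi | lra]).
  split; [exact A |].
  apply (node_map_spec _ _ _ _ (Hs i) A).
Qed.

(** * Bi-infinite itineraries *)

Lemma bounded_cluster (v : nat -> R) (a b : R) :
  (forall n, a <= v n <= b) ->
  exists l, forall e N, 0 < e -> exists n, (N <= n)%nat /\ Rabs (v n - l) < e.
Proof.
  intros H.
  destruct (Bolzano_Weierstrass v (fun x => a <= x <= b) (compact_P3 a b) H)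
    as [l Hl].
  exists l. intros e N He.
  destruct (Hl (disc l (mkposreal e He)) N) as [n [Hn Hd]].
  - exists (mkposreal e He). intros x Hx; exact Hx.
  - exists n. split; [exact Hn | exact Hd].
Qed.

(* [l] is a cluster point of [u] for the first [k] coordinates; the product
   compactness is obtained by extending [l] one coordinate at a time. *)
Definition cluster_below (u : nat -> nat -> R) (k : nat) (l : nat -> R) : Prop :=
  forall e N, 0 < e -> exists n, (N <= n)%nat /\
    forall i, (i < k)%nat -> Rabs (u n i - l i) < e.

(** Along times [n q] at which the first [k] coordinates are within [1 / (q + 1)] of [l], the next
    coordinate has a cluster value by compactness. *)
Lemma cluster_below_extend (u : nat -> nat -> R) (a b : R) (k : nat) (l : nat -> R) :
  (forall n i, a <= u n i <= b) -> cluster_below u k l ->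
  exists l', (forall i, (i < k)%nat -> l' i = l i) /\ cluster_below u (S k) l'.
Proof.
  intros Hu Hl.
  destruct (choice (fun q n => (q <= n)%nat /\
    forall i, (i < k)%nat -> Rabs (u n i - l i) < / (INR q + 1))) as [n Hn].
  { intros q. apply Hl. apply Rinv_0_lt_compat. assert (H := pos_INR q). lra. }
  destruct (bounded_cluster (fun q => u (n q) k) a b) as [lk Hk]; [intros; apply Hu |].
  exists (fun i => if Nat.eqb i k then lk else l i). split.
  { intros i Hi. destruct (Nat.eqb_spec i k); [lia | reflexivity]. }
  intros e N He.
  destruct (archimed_cor1 e He) as (q0 & Hq0 & Hq0').
  destruct (Hk e (Nat.max N q0) He) as (q & Hq & Hqk).
  destruct (Hn q) as [Hnq Hnl].
  exists (n q). split; [lia |]. intros i Hi.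
  destruct (Nat.eqb_spec i k) as [-> | Hne]; [exact Hqk |].
  apply Rlt_trans with (/ (INR q + 1)); [apply Hnl; lia |].
  apply Rlt_trans with (/ INR q0); [| exact Hq0].
  assert (INR q0 <= INR q) by (apply le_INR; lia).
  assert (0 < INR q0) by (apply lt_0_INR; lia).
  apply Rinv_lt_contravar; [apply Rmult_lt_0_compat |]; lra.
Qed.

Lemma bounded_cluster_nat (u : nat -> nat -> R) (a b : R) :
  (forall n i, a <= u n i <= b) -> exists l, forall k, cluster_below u k l.
Proof.
  intros Hu.
  (* The extension is chosen as a total function, with [l] itself as the default value, so that [L]
     can be defined by plain recursion. Coordinate [i] of [L k] is then frozen once [k > i]. *)
  destruct (choice (fun kl (l' : nat -> R) => let (k, l) := (kl : nat * (nat -> R)) in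
    cluster_below u k l ->
    (forall i, (i < k)%nat -> l' i = l i) /\ cluster_below u (S k) l')) as [ext Hext].
  { intros [k l]. destruct (excluded_middle_informative (cluster_below u k l)) as [H | H].
    - destruct (cluster_below_extend u a b k l Hu H) as [l' Hl']. exists l'. auto.
    - exists l. tauto. }
  set (L := fix L k := match k with O => fun _ => 0 | S k => ext (k, L k) end).
  assert (HL : forall k, cluster_below u k (L k)).
  { induction k as [| k IH].
    - intros e N _. exists N. split; [lia | intros i Hi; lia].
    - apply (Hext (k, L k)), IH. }
  assert (Hst : forall k i, (i < k)%nat -> L k i = L (S i) i).
  { induction k as [| k IH]; intros i Hi; [lia |].
    destruct (Nat.eq_dec i k) as [-> | Hne]; [reflexivity |].
    transitivity (L k i); [| apply IH; lia].
    apply (Hext (k, L k) (HL k)). lia. }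
  exists (fun i => L (S i) i). intros k e N He.
  destruct (HL k e N He) as (n & Hn & H). exists n. split; [exact Hn |].
  intros i Hi. rewrite <- (Hst k i Hi). apply H, Hi.
Qed.

(** Numbers the real coordinates of a sequence of pairs indexed by [Z]; [true] stands for the first
    component. The integer 0 is coded twice: surjectivity is what is used. *)
Definition coordinate (i : nat) : Z * bool :=
  let q := Nat.div2 i in
  ((if Nat.even q then Z.of_nat (Nat.div2 q) else - Z.of_nat (Nat.div2 q))%Z,
   Nat.even i).

Lemma coordinate_surj (j : Z) (c : bool) : exists i, coordinate i = (j, c).
Proof.
  assert (H : exists q, (if Nat.even q then Z.of_nat (Nat.div2 q)
    else - Z.of_nat (Nat.div2 q))%Z = j).
  { destruct (Z_le_gt_dec 0 j) as [Hj | Hj].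
    - exists (2 * Z.to_nat j)%nat. rewrite Nat.div2_double.
      replace (Nat.even _) with true by (symmetry; apply Nat.even_spec; eexists; reflexivity).
      lia.
    - exists (S (2 * Z.to_nat (- j)))%nat. rewrite Nat.div2_succ_double.
      rewrite Nat.even_succ.
      replace (Nat.odd _) with false by (rewrite <- Nat.negb_even;
        replace (Nat.even _) with true by
        (symmetry; apply Nat.even_spec; eexists; reflexivity); reflexivity).
      lia. }
  destruct H as [q Hq]. unfold coordinate. destruct c.
  - exists (2 * q)%nat. rewrite Nat.div2_double, Hq.
    replace (Nat.even _) with true by (symmetry; apply Nat.even_spec; eexists; reflexivity).
    reflexivity.
  - exists (S (2 * q)). rewrite Nat.div2_succ_double, Hq, Nat.even_succ.
    replace (Nat.odd _) with false by (rewrite <- Nat.negb_even;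
        replace (Nat.even _) with true by
        (symmetry; apply Nat.even_spec; eexists; reflexivity); reflexivity).
    reflexivity.
Qed.

(** The subsequence may depend on [j], and it converges at [j] and [j + 1]: the conditions to be
    passed to the limit involve two consecutive states. *)
Lemma bounded_cluster_sequence (p : nat -> Z -> R * R) (a b : R) :
  (forall n j, a <= fst (p n j) <= b /\ a <= snd (p n j) <= b) ->
  exists l : Z -> R * R, forall j, exists s : nat -> nat,
    (forall q, (q <= s q)%nat) /\
    is_lim_seq (fun q => fst (p (s q) j)) (fst (l j)) /\
    is_lim_seq (fun q => snd (p (s q) j)) (snd (l j)) /\
    is_lim_seq (fun q => fst (p (s q) (j + 1)%Z)) (fst (l (j + 1)%Z)) /\
    is_lim_seq (fun q => snd (p (s q) (j + 1)%Z)) (snd (l (j + 1)%Z)).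
Proof.
  intros Hp.
  set (pr := fun (c : Z * bool) n =>
    if snd c then fst (p n (fst c)) else snd (p n (fst c))).
  destruct (bounded_cluster_nat (fun n i => pr (coordinate i) n) a b) as [l Hl].
  { intros n i. unfold pr. destruct (snd (coordinate i)); apply Hp. }
  destruct (choice (fun c i => coordinate i = c)) as [code Hcode].
  { intros [j c]. apply coordinate_surj. }
  exists (fun j => (l (code (j, true)), l (code (j, false)))). intros j. simpl.
  set (k := (1 + code (j, true) + code (j, false) + code ((j + 1)%Z, true)
    + code ((j + 1)%Z, false))%nat).
  destruct (choice (fun q n => (q <= n)%nat /\ forall i, (i < k)%nat ->
    Rabs (pr (coordinate i) n - l i) < / (INR q + 1))) as [s Hs].
  { intros q. apply (Hl k). apply Rinv_0_lt_compat. assert (H := pos_INR q). lra. }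
  exists s. split; [intros q; apply Hs |].
  assert (H : forall i, (i < k)%nat -> is_lim_seq (fun q => pr (coordinate i) (s q)) (l i)).
  { intros i Hi. apply is_lim_seq_spec. intros e.
    destruct (archimed_cor1 e (cond_pos e)) as (q0 & Hq0 & Hq0').
    exists q0. intros q Hq.
    apply Rlt_trans with (/ (INR q + 1)); [apply Hs, Hi |].
    apply Rlt_trans with (/ INR q0); [| exact Hq0].
    assert (INR q0 <= INR q) by (apply le_INR; lia).
    assert (0 < INR q0) by (apply lt_0_INR; lia).
    apply Rinv_lt_contravar; [apply Rmult_lt_0_compat |]; lra. }
  assert (H' : forall c, (code c < k)%nat ->
    is_lim_seq (fun q => pr c (s q)) (l (code c))).
  { intros c Hc. specialize (H _ Hc). rewrite Hcode in H. exact H. }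
  repeat split.
  - apply (H' (j, true)). lia.
  - apply (H' (j, false)). lia.
  - apply (H' ((j + 1)%Z, true)). lia.
  - apply (H' ((j + 1)%Z, false)). lia.
Qed.

Lemma is_lim_seq_affine (f g : nat -> R) (a b c x y : R) :
  is_lim_seq f x -> is_lim_seq g y ->
  is_lim_seq (fun n => a + b * f n + c * g n) (a + b * x + c * y).
Proof.
  intros Hf Hg. apply is_lim_seq_plus'; [apply is_lim_seq_plus' |].
  - apply is_lim_seq_const.
  - apply (is_lim_seq_scal_l f b x Hf).
  - apply (is_lim_seq_scal_l g c y Hg).
Qed.

Lemma is_lim_seq_ge0 (f : nat -> R) (x : R) (N : nat) :
  is_lim_seq f x -> (forall n, (N <= n)%nat -> 0 <= f n) -> 0 <= x.
Proof.
  intros Hf Hn.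
  apply (is_lim_seq_le_loc (fun _ => 0) f 0 x); [| apply is_lim_seq_const | exact Hf].
  exists N. exact Hn.
Qed.

Lemma is_lim_seq_cos (f : nat -> R) (x : R) :
  is_lim_seq f x -> is_lim_seq (fun n => cos (f n)) (cos x).
Proof.
  intros Hf. apply (is_lim_seq_continuous cos f x); [apply continuity_cos | exact Hf].
Qed.

Lemma is_lim_seq_exit_gap (d m : R) (p : nat -> R * R) (l : R * R) :
  is_lim_seq (fun n => fst (p n)) (fst l) ->
  is_lim_seq (fun n => snd (p n)) (snd l) ->
  is_lim_seq (fun n => exit_gap d m (p n)) (exit_gap d m l).
Proof.
  intros H1 H2.
  apply is_lim_seq_ext with
    (fun n => d + (-1) * fst (p n) + (- 2 * (m - 1)) * snd (p n)).
  { intros n. unfold exit_gap. ring. }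
  replace (exit_gap d m l) with (d + (-1) * fst l + (- 2 * (m - 1)) * snd l)
    by (unfold exit_gap; ring).
  apply is_lim_seq_affine; assumption.
Qed.

Lemma admissible_closed (d m : R) (p : nat -> R * R) (l : R * R) (N : nat) :
  is_lim_seq (fun n => fst (p n)) (fst l) ->
  is_lim_seq (fun n => snd (p n)) (snd l) ->
  (forall n, (N <= n)%nat -> admissible d m (p n)) -> admissible d m l.
Proof.
  intros H1 H2 Hp. assert (H3 := is_lim_seq_exit_gap d m p l H1 H2).
  assert (H4 := is_lim_seq_affine _ _ 0 (-1) 2 _ _ H1 H2).
  assert (H5 := is_lim_seq_affine _ _ 0 (-1) 2 _ _ H3 H2).
  apply is_lim_seq_ge0 with (N := N) in H1, H3, H4, H5;
    [split; lra | ..]; intros n Hn; destruct (Hp n Hn); lra.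
Qed.

Lemma is_lim_seq_null (f : nat -> R) (x : R) (N : nat) :
  is_lim_seq f x -> (forall n, (N <= n)%nat -> f n = 0) -> x = 0.
Proof.
  intros Hf Hn. apply Rle_antisym.
  - assert (H := is_lim_seq_affine f f 0 (-1) 0 x x Hf Hf).
    apply is_lim_seq_ge0 with (N := N) in H; [lra |].
    intros n Hn'. rewrite (Hn n Hn'). lra.
  - apply is_lim_seq_ge0 with (N := N) in Hf; [exact Hf |].
    intros n Hn'. rewrite (Hn n Hn'). lra.
Qed.

Lemma linked_closed (d m mu : R) (p q : nat -> R * R) (l l' : R * R) (N : nat) :
  is_lim_seq (fun n => fst (p n)) (fst l) ->
  is_lim_seq (fun n => snd (p n)) (snd l) ->
  is_lim_seq (fun n => fst (q n)) (fst l') ->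
  is_lim_seq (fun n => snd (q n)) (snd l') ->
  (forall n, (N <= n)%nat -> linked d m mu (p n) (q n)) -> linked d m mu l l'.
Proof.
  intros H1 H2 H1' H2' Hp. assert (H3 := is_lim_seq_exit_gap d m p l H1 H2).
  split.
  - assert (H4 := is_lim_seq_affine _ _ 0 1 1 _ _
      (is_lim_seq_affine _ _ 0 (-1) 1 _ _ H1' H2')
      (is_lim_seq_affine _ _ 0 1 (-1) _ _ H2 H3)).
    apply is_lim_seq_null with (N := N) in H4; [lra |].
    intros n Hn. destruct (Hp n Hn) as [E _]. lra.
  - assert (H4 := is_lim_seq_affine _ _ 0 1 1 _ _
      (is_lim_seq_affine _ _ 0 (1 - mu²) mu² _ _
        (is_lim_seq_cos _ _ (is_lim_seq_affine _ _ 0 1 (-1) _ _ H3 H2))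
        (is_lim_seq_cos _ _ H2))
      (is_lim_seq_affine _ _ 0 (-1) 0 _ _ (is_lim_seq_cos _ _ H2') H2')).
    unfold exit_cos.
    replace (exit_gap d m l - snd l)
      with (0 + 1 * exit_gap d m l + (-1) * snd l) by ring.
    apply is_lim_seq_null with (N := N) in H4; [lra |].
    intros n Hn. destruct (Hp n Hn) as [_ E]. rewrite E. unfold exit_cos.
    replace (exit_gap d m (p n) - snd (p n))
      with (0 + 1 * exit_gap d m (p n) + (-1) * snd (p n)) by ring.
    ring.
Qed.

(** Itineraries over the windows [[- n, n]] have a coordinatewise cluster point; each condition at
    [j] is closed and holds as soon as the window contains [j] and [j + 1]. *)
Lemma infinite_itinerary (d m mu : Z -> R) :
  (forall j, small_angles (d j) (m j) (mu j)) ->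
  (forall j, jump (d j) (m j) (mu j) (d (j + 1)%Z) (m (j + 1)%Z)) ->
  exists p : Z -> R * R, forall j,
    admissible (d j) (m j) (p j) /\
    linked (d j) (m j) (mu j) (p j) (p (j + 1)%Z).
Proof.
  intros Hs Hj.
  assert (Hfin : forall n : nat, exists p : Z -> R * R,
    (forall j, 0 <= fst (p j) <= 2 /\ 0 <= snd (p j) <= 2) /\
    forall j, (- Z.of_nat n <= j < Z.of_nat n)%Z ->
      admissible (d j) (m j) (p j) /\
      linked (d j) (m j) (mu j) (p j) (p (j + 1)%Z)).
  { intros n.
    set (sh := fun i : nat => (Z.of_nat i - Z.of_nat n)%Z).
    destruct (finite_itinerary (fun i => d (sh i)) (fun i => m (sh i))
      (fun i => mu (sh i)) (2 * n)) as [p Hp].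
    { intros i. apply Hs. }
    { intros i. replace (sh (S i)) with (sh i + 1)%Z by (unfold sh; lia). apply Hj. }
    (* Outside the window the state is set to [(0, 0)], which keeps all coordinates in [[0, 2]]. *)
    exists (fun j => if Z_le_dec (- Z.of_nat n) j then
      if Z_le_dec j (Z.of_nat n) then p (Z.to_nat (j + Z.of_nat n)) else (0, 0)
      else (0, 0)).
    split.
    - intros j. destruct (Z_le_dec _ _); [destruct (Z_le_dec _ _) |]; simpl; try lra.
      destruct (Hp (Z.to_nat (j + Z.of_nat n))) as [Ha _]; [lia |].
      destruct (admissible_angle _ _ _ _ (Hs _) Ha) as (Ht & _).
      destruct Ha as [Hy _]. lra.
    - intros j Hjn. destruct (Hp (Z.to_nat (j + Z.of_nat n))) as [Ha Hl]; [lia |].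
      replace (sh (Z.to_nat (j + Z.of_nat n))) with j in Ha, Hl by (unfold sh; lia).
      replace (S (Z.to_nat (j + Z.of_nat n))) with (Z.to_nat (j + 1 + Z.of_nat n))
        in Hl by lia.
      repeat destruct (Z_le_dec _ _); try lia. split; assumption. }
  destruct (choice _ Hfin) as [p Hp].
  destruct (bounded_cluster_sequence p 0 2) as [l Hl]; [intros n; apply Hp |].
  exists l. intros j. destruct (Hl j) as (s & Hsq & L1 & L2 & L3 & L4).
  assert (HN : forall q, (Z.abs_nat j + 1 <= q)%nat ->
    (- Z.of_nat (s q) <= j < Z.of_nat (s q))%Z).
  { intros q Hq. specialize (Hsq q). lia. }
  split.
  - apply (admissible_closed _ _ (fun q => p (s q) j) (l j) (Z.abs_nat j + 1) L1 L2).
    intros q Hq. apply Hp, HN, Hq.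
  - apply (linked_closed _ _ _ (fun q => p (s q) j) (fun q => p (s q) (j + 1)%Z)
      (l j) (l (j + 1)%Z) (Z.abs_nat j + 1) L1 L2 L3 L4).
    intros q Hq. apply Hp, HN, Hq.
Qed.

(** * From itineraries to billiard trajectories *)

Lemma cis_plus (a b : R) : cis (a + b) = (cis a * cis b)%C.
Proof.
  unfold cis, Cmult; simpl. rewrite cos_plus, sin_plus. f_equal; ring.
Qed.

Lemma cis_shift (a : R) (n : Z) : cis (a + 2 * PI * IZR n) = cis a.
Proof.
  assert (H : forall (b : R) (k : nat), cis (b + 2 * PI * INR k) = cis b).
  { intros b k. unfold cis.
    replace (b + 2 * PI * INR k) with (b + 2 * INR k * PI) by ring.
    rewrite cos_period, sin_period. reflexivity. }
  destruct (Z_le_gt_dec 0 n) as [Hn | Hn].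
  - rewrite <- (Z2Nat.id n Hn), <- INR_IZR_INZ. apply H.
  - rewrite <- (H (a + 2 * PI * IZR n) (Z.to_nat (- n))). f_equal.
    rewrite INR_IZR_INZ, Z2Nat.id by lia. rewrite opp_IZR. ring.
Qed.

Lemma z_shift (G : circular_polygon) (a : R) (n : Z) :
  z G (a + 2 * PI * IZR n) = z G a.
Proof.
  destruct (z_simple_closed G) as (_ & Hper & _).
  assert (H : forall (b : R) (k : nat), z G (b + 2 * PI * INR k) = z G b).
  { intros b k. induction k as [| k IH].
    - simpl. f_equal. ring.
    - rewrite S_INR, <- IH, <- (Hper (b + 2 * PI * INR k)). f_equal. ring. }
  destruct (Z_le_gt_dec 0 n) as [Hn | Hn].
  - rewrite <- (Z2Nat.id n Hn), <- INR_IZR_INZ. apply H.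
  - rewrite <- (H (a + 2 * PI * IZR n) (Z.to_nat (- n))). f_equal.
    rewrite INR_IZR_INZ, Z2Nat.id by lia. rewrite opp_IZR. ring.
Qed.

Definition reduce (a : R) : R := a + 2 * PI * IZR (- Zfloor (a / (2 * PI))).

Lemma reduce_bounds (a : R) : 0 <= reduce a < 2 * PI.
Proof.
  unfold reduce. assert (P := PI_RGT_0). rewrite opp_IZR.
  destruct (Zfloor_bound (a / (2 * PI))) as [H1 H2].
  set (k := IZR (Zfloor (a / (2 * PI)))) in *.
  assert (E : a = 2 * PI * (a / (2 * PI))) by (field; lra).
  set (q := a / (2 * PI)) in *.
  rewrite E. split; nra.
Qed.

Lemma z_reduce (G : circular_polygon) (a : R) : z G (reduce a) = z G a.
Proof. apply z_shift. Qed.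

Lemma tangent_reduce (a : R) : tangent (reduce a) = tangent a.
Proof. unfold tangent, reduce. rewrite cis_shift. reflexivity. Qed.

Lemma z_neq (G : circular_polygon) (a b : R) :
  0 < b - a < 2 * PI -> z G b <> z G a.
Proof.
  intros Hab E. destruct (z_simple_closed G) as (_ & _ & Hinj).
  destruct (Hinj _ _ (eq_sym E)) as [k Hk].
  assert (P := PI_RGT_0).
  assert (0 < IZR k < 1) by (split; nra).
  destruct H as [H1 H2]. apply lt_IZR in H1, H2. lia.
Qed.

(** The chord direction is the tangent at [a] turned by [t], and a further turn by [t'] gives the
    tangent at [a + t + t']. The endpoints differ because [0 < t + t' < 2 * PI]. *)
Lemma billiard_of_chord (G : circular_polygon) (a b t t' c : R) :
  0 < t < PI -> 0 < t' < PI -> b = a + t + t' ->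
  z G b = (z G a + RtoC c * (Ci * cis (a + t)))%C ->
  billiard G (reduce a, t) (reduce b, t').
Proof.
  intros Ht Ht' Hb Hz. unfold billiard, phase_point; simpl fst; simpl snd.
  rewrite !z_reduce, !tangent_reduce.
  assert (Hv : (cis t * tangent a)%C = (Ci * cis (a + t))%C).
  { unfold tangent. rewrite cis_plus. ring. }
  rewrite Hv.
  split; [split; [apply reduce_bounds | lra] |].
  split; [split; [apply reduce_bounds | lra] |].
  split; [apply z_neq; lra |].
  split; [exists c; exact Hz |].
  unfold tangent. rewrite Hb, !cis_plus. ring.
Qed.

Lemma billiard_same_arc (G : circular_polygon) (j : Z) (a t : R) :
  0 < t < PI -> start G j <= a -> a + 2 * t <= start G (j + 1) ->
  billiard G (reduce a, t) (reduce (a + 2 * t), t).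
Proof.
  intros Ht Ha Hb.
  apply billiard_of_chord with (2 * radius G j * sin t); try lra.
  rewrite !(polar G j) by lra.
  replace (a + 2 * t) with ((a + t) + t) by ring.
  replace a with ((a + t) - t) at 2 by ring.
  generalize (a + t). intros w. unfold cis, Ci, RtoC, Cplus, Cmult; simpl.
  rewrite cos_plus, sin_plus, cos_minus, sin_minus. f_equal; ring.
Qed.

(** The chord is the sum of the vectors from its start to the node and from the node to its end,
    written in the frame [cis w], [Ci * cis w] with [w = b - x + t]. The relation between the radii
    says that the component on [cis w] vanishes; the other one is the coefficient given below. *)
Lemma billiard_node_crossing (G : circular_polygon) (j : Z) (x t y t' : R) :
  0 < t < PI -> 0 < t' < PI -> y = t' + t - x ->
  0 <= x <= start G (j + 1) - start G j ->
  0 <= y <= start G (j + 1 + 1) - start G (j + 1) ->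
  radius G (j + 1) * (cos t' - cos (x - t)) = radius G j * (cos t - cos (x - t)) ->
  billiard G (reduce (start G (j + 1) - x), t) (reduce (start G (j + 1) + y), t').
Proof.
  intros Ht Ht' Ey Hx Hy E.
  assert (Hnode := polar G j (start G (j + 1))).
  rewrite (polar G (j + 1)) in Hnode by lra.
  assert (Hb := start_incr G j).
  specialize (Hnode ltac:(lra)).
  set (b := start G (j + 1)) in *.
  apply billiard_of_chord with
    (radius G (j + 1) * (sin t' - sin (x - t)) + radius G j * (sin (x - t) + sin t)); try lra.
  rewrite (polar G j (b - x)), (polar G (j + 1) (b + y)) by (fold b; lra).
  set (w := b - x + t).
  replace (b + y) with (w + t') by (unfold w; lra).
  replace (b - x) with (w - t) by (unfold w; ring).
  replace b with (w + (x - t)) in Hnode by (unfold w; ring).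
  revert Hnode E. generalize (center G j) (center G (j + 1)).
  intros [O1 O2] [O1' O2'] Hnode E.
  assert (H1 := f_equal fst Hnode). assert (H2 := f_equal snd Hnode).
  clear Hnode. unfold cis, Ci, RtoC, Cplus, Cmult in *; simpl in *.
  rewrite cos_plus in H1. rewrite sin_plus in H2.
  rewrite !cos_plus, !sin_plus, cos_minus, sin_minus.
  set (u := x - t) in *. set (r := radius G j) in *. set (r' := radius G (j + 1)) in *.
  assert (F1 : cos w * (r' * (cos t' - cos u)) = cos w * (r * (cos t - cos u)))
    by (rewrite E; reflexivity).
  assert (F2 : sin w * (r' * (cos t' - cos u)) = sin w * (r * (cos t - cos u)))
    by (rewrite E; reflexivity).
  f_equal; lra.
Qed.

(** * Difference of consecutive radii *)

Lemma is_derive_pair (f g : R -> R) (x a b : R) :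
  is_derive f x a -> is_derive g x b ->
  @is_derive R_AbsRing C_R_NormedModule (fun t => (f t, g t)) x (a, b).
Proof.
  intros Hf Hg.
  apply (filterdiff_ext_lin (V := C_R_NormedModule) (fun t : R => (f t, g t))
    (fun y : R => (scal y a, scal y b))); [| intros y; reflexivity].
  apply (@filterdiff_comp_2 R_AbsRing R_NormedModule R_NormedModule R_NormedModule
    C_R_NormedModule _ _ f g (fun x y => (x, y)) (fun y => scal y a) (fun y => scal y b)
    (fun x y => (x, y))); [exact Hf | exact Hg |].
  apply filterdiff_linear.
  split; try reflexivity.
  exists 1. split; [lra |]. intros [u v]. rewrite Rmult_1_l. apply Rle_refl.
Qed.

Lemma continuous_pair (f g : R -> R) (x : R) :
  continuous f x -> continuous g x ->
  continuous (fun t => (f t, g t) : C) x.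
Proof.
  intros Hf Hg.
  apply (continuous_comp_2 f g (fun x y => (x, y)) x Hf Hg).
  apply continuous_ext with (fun p : R * R => p); [intros [u v]; reflexivity |].
  apply continuous_id.
Qed.

(** With equal radii the common endpoint forces equal centers; both arcs then lie on one circle,
    which is smooth at the node. *)
Lemma consecutive_radii (G : circular_polygon) (j : Z) :
  radius G j <> radius G (j + 1).
Proof.
  intros Hr. apply (node_not_C2 G (j + 1)).
  assert (S1 := start_incr G j). assert (S2 := start_incr G (j + 1)).
  assert (Hnode := polar G j (start G (j + 1))).
  rewrite (polar G (j + 1)) in Hnode by lra. rewrite <- Hr in Hnode.
  assert (Hc : center G (j + 1) = center G j).
  { specialize (Hnode ltac:(lra)).
    set (q := (RtoC (radius G j) * cis (start G (j + 1)))%C) in *.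
    transitivity ((center G (j + 1) + q) - q)%C; [ring |]. rewrite Hnode. ring. }
  clear Hnode.
  set (b := start G (j + 1)) in *. set (r := radius G j) in *.
  assert (Hr0 : 0 < r) by apply radius_pos.
  destruct (center G j) as [o1 o2] eqn:Ho.
  exists (Rmin (b - start G j) (start G (j + 1 + 1) - b)), (fun t => b + t),
    (fun i => match i with
     | O => fun t => (o1 + r * cos (b + t), o2 + r * sin (b + t))
     | S O => fun t => (- r * sin (b + t), r * cos (b + t))
     | _ => fun t => (- r * cos (b + t), - r * sin (b + t))
     end).
  split; [apply Rmin_pos; lra |]. split; [ring |].
  split; [intros t _; apply (continuous_plus (fun _ => b) (fun t => t));
    [apply continuous_const | apply continuous_id] |].
  split; [intros; lra |].
  split.
  { intros t Ht. assert (H1 := Rmin_l (b - start G j) (start G (j + 1 + 1) - b)).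
    assert (H2 := Rmin_r (b - start G j) (start G (j + 1 + 1) - b)).
    apply Rabs_def2 in Ht.
    destruct (Rle_lt_dec t 0) as [H0 | H0].
    - rewrite (polar G j) by (fold b; lra). rewrite Ho. fold r.
      unfold cis, RtoC, Cplus, Cmult; simpl. f_equal; ring.
    - rewrite (polar G (j + 1)) by (fold b; lra). rewrite Hc, <- Hr.
      unfold cis, RtoC, Cplus, Cmult; simpl. f_equal; ring. }
  split.
  { intros i t Hi _. destruct i as [| [| i]]; [| | lia];
      apply is_derive_pair; auto_derive; trivial; ring. }
  split.
  { intros t _. apply continuous_pair;
    apply (@ex_derive_continuous R_AbsRing R_NormedModule); auto_derive; trivial. }
  intros t _ E. assert (E1 := f_equal fst E). assert (E2 := f_equal snd E).
  simpl in E1, E2. assert (Hsc := sin2_cos2 (b + t)). unfold Rsqr in Hsc.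
  assert (sin (b + t) = 0) by nra. assert (cos (b + t) = 0) by nra. nra.
Qed.

(** * Numbering of the impacts arc by arc *)

Lemma cumulative (m : Z -> Z) :
  exists N : Z -> Z, N 0%Z = 0%Z /\ forall j, N (j + 1)%Z = (N j + m j)%Z.
Proof.
  set (f := fix f n := match n with O => 0%Z | S n => (f n + m (Z.of_nat n))%Z end).
  set (g := fix g n := match n with O => 0%Z | S n => (g n + m (- 1 - Z.of_nat n))%Z end).
  exists (fun j => if Z_le_dec 0 j then f (Z.to_nat j) else (- g (Z.to_nat (- j)))%Z).
  split; [reflexivity |]. intros j.
  destruct (Z_le_dec 0 j) as [H | H]; destruct (Z_le_dec 0 (j + 1)) as [H' | H']; try lia.
  - replace (Z.to_nat (j + 1)) with (S (Z.to_nat j)) by lia. simpl.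
    do 2 f_equal. lia.
  - replace j with (-1)%Z by lia. simpl. lia.
  - replace (Z.to_nat (- j)) with (S (Z.to_nat (- (j + 1)))) by lia.
    set (k := Z.to_nat (- (j + 1))).
    change (g (S k)) with (g k + m (- 1 - Z.of_nat k))%Z.
    replace (- 1 - Z.of_nat k)%Z with j by (unfold k; lia). lia.
Qed.

(** [N j] will number the first impact in arc [j], and [J n] will be the arc of impact [n]. As [N]
    is strictly increasing, the blocks from [N j] to [N (j + 1)] tile the integers. *)
Lemma block_index (m : Z -> Z) :
  (forall j, (1 <= m j)%Z) ->
  exists (N J : Z -> Z), J 0%Z = 0%Z /\ N 0%Z = 0%Z /\
    (forall n, (N (J n) <= n < N (J n) + m (J n))%Z) /\
    (forall n, J (n + 1)%Z = J n /\ (n + 1 < N (J n) + m (J n))%Z \/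
       J (n + 1)%Z = (J n + 1)%Z /\ (n + 1 = N (J n) + m (J n))%Z /\
       N (J n + 1)%Z = (n + 1)%Z) /\
    (forall j, J (N j) = j).
Proof.
  intros Hm. destruct (cumulative m) as (N & N0 & HN).
  assert (Hinc : forall j (k : nat), (N j + Z.of_nat k <= N (j + Z.of_nat k))%Z).
  { intros j k. induction k as [| k IH]; [rewrite !Z.add_0_r; lia |].
    replace (j + Z.of_nat (S k))%Z with ((j + Z.of_nat k) + 1)%Z by lia.
    rewrite HN. specialize (Hm (j + Z.of_nat k)%Z). lia. }
  assert (Hlt : forall i j, (i < j)%Z -> (N (i + 1)%Z <= N j)%Z).
  { intros i j Hij. assert (H := Hinc (i + 1)%Z (Z.to_nat (j - (i + 1)))).
    replace (i + 1 + Z.of_nat (Z.to_nat (j - (i + 1))))%Z with j in H by lia. lia. }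
  assert (Huniq : forall i j n,
    (N i <= n < N (i + 1))%Z -> (N j <= n < N (j + 1))%Z -> i = j).
  { intros i j n Hi Hj. destruct (Z.lt_total i j) as [H | [H | H]]; [| exact H |];
      apply Hlt in H; lia. }
  assert (Hex : forall n, exists j, (N j <= n < N (j + 1))%Z).
  { apply Z.peano_ind.
    - exists 0%Z. rewrite HN. specialize (Hm 0%Z). lia.
    - intros n [j Hj]. destruct (Z_lt_le_dec (Z.succ n) (N (j + 1)%Z)).
      + exists j. lia.
      + exists (j + 1)%Z. rewrite (HN (j + 1)%Z). specialize (Hm (j + 1)%Z). lia.
    - intros n [j Hj]. destruct (Z_le_gt_dec (N j) (Z.pred n)).
      + exists j. lia.
      + exists (j - 1)%Z. replace (j - 1 + 1)%Z with j by lia.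
        assert (H := HN (j - 1)%Z). replace (j - 1 + 1)%Z with j in H by lia.
        specialize (Hm (j - 1)%Z). lia. }
  destruct (choice _ Hex) as [J HJ].
  assert (HJN : forall j, J (N j) = j).
  { intros j. apply (Huniq _ _ (N j) (HJ _)). rewrite HN. specialize (Hm j). lia. }
  exists N, J. split; [rewrite <- N0 at 1; apply HJN |]. split; [exact N0 |].
  split; [intros n; rewrite <- HN; apply HJ |]. split; [| exact HJN].
  intros n. assert (H := HJ n).
  destruct (Z_lt_le_dec (n + 1) (N (J n + 1)%Z)) as [H1 | H1].
  - left. split; [| rewrite <- HN; exact H1].
    apply (Huniq _ _ (n + 1)%Z (HJ _)). lia.
  - right. assert (E : N (J n + 1)%Z = (n + 1)%Z) by lia.
    split; [rewrite <- E at 1; apply HJN |]. rewrite <- HN. lia.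
Qed.

(** The length is angular, measured in polar parameter. *)
Definition arc_length (G : circular_polygon) (j : Z) : R :=
  start G (j + 1) - start G j.

Definition node_ratio (G : circular_polygon) (j : Z) : R :=
  sqrt (radius G j / radius G (j + 1)).

Lemma sliding_trajectory (G : circular_polygon) (m : Z -> Z) :
  (forall j, small_angles (arc_length G j) (IZR (m j)) (node_ratio G j)) ->
  (forall j, jump (arc_length G j) (IZR (m j)) (node_ratio G j)
    (arc_length G (j + 1)) (IZR (m (j + 1)%Z))) ->
  exists (s : Z -> R * R) (J : Z -> Z),
    J 0%Z = 0%Z /\
    (forall n, (J n <= J (n + 1) <= J n + 1)%Z) /\
    (forall j, exists n, J n = j) /\
    (forall n, billiard G (s n) (s (n + 1)%Z)) /\
    (forall n, sliding_at G lam_0 s n) /\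
    (forall n, 2 * (IZR (m (J n)) - 1) * snd (s n) <= arc_length G (J n) <=
       2 * (IZR (m (J n)) + 1) * snd (s n)).
Proof.
  intros Hs Hj.
  destruct (infinite_itinerary _ _ _ Hs Hj) as [p Hp].
  assert (Hm : forall j, (2 <= m j)%Z).
  { intros j. destruct (Hs j) as (_ & _ & H & _). apply le_IZR, H. }
  destruct (block_index m) as (N & J & J0 & N0 & HJ & Hstep & HJN);
    [intros j; specialize (Hm j); lia |].
  assert (P := PI2_1).
  (* Successive impacts in one arc are [2 t] apart, counted from the entry point. *)
  set (pos := fun n => start G (J n) + fst (p (J n)) +
    2 * IZR (n - N (J n)) * snd (p (J n))).
  set (s := fun n => (reduce (pos n), snd (p (J n)))).
  assert (Hpos : forall n, start G (J n) <= pos n <= start G (J n + 1)).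
  { intros n. destruct (Hp (J n)) as [[Hy Hx] _]. specialize (HJ n).
    unfold exit_gap, arc_length in Hx. unfold pos.
    assert (H1 : 0 <= IZR (n - N (J n))) by (apply (IZR_le 0); lia).
    assert (H2 : IZR (n - N (J n)) <= IZR (m (J n)) - 1)
      by (rewrite <- minus_IZR; apply IZR_le; lia).
    split; nra. }
  exists s, J. split; [exact J0 |].
  split; [intros n; destruct (Hstep n) as [[E _] | [E _]]; lia |].
  split; [intros j; exists (N j); apply HJN |].
  split; [| split].
  - intros n. destruct (Hp (J n)) as [Ha [L1 L2]].
    destruct (admissible_angle _ _ _ _ (Hs (J n)) Ha) as (Ht & _ & _).
    specialize (HJ n). destruct (Hstep n) as [[E H1] | [E [H1 H1']]].
    + replace (s (n + 1)%Z) with (reduce (pos n + 2 * snd (p (J n))), snd (p (J n))).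
      * assert (Hpn := Hpos (n + 1)%Z). rewrite E in Hpn.
        replace (pos (n + 1)%Z) with (pos n + 2 * snd (p (J n))) in Hpn.
        -- apply (billiard_same_arc G (J n)); [lra | apply Hpos | apply Hpn].
        -- unfold pos. rewrite E. rewrite !minus_IZR, plus_IZR. ring.
      * unfold s, pos. rewrite E. do 2 f_equal.
        rewrite !minus_IZR, plus_IZR. ring.
    + destruct (Hp (J n + 1)%Z) as [Ha' _].
      destruct (admissible_angle _ _ _ _ (Hs (J n + 1)%Z) Ha') as (Ht' & _ & _).
      set (x := exit_gap (arc_length G (J n)) (IZR (m (J n))) (p (J n))) in *.
      (* The last impact in an arc has rank [m - 1], and the exit gap is what separates it from the
         node. *)
      assert (Epos : pos n = start G (J n + 1) - x).
      { unfold pos, x, exit_gap, arc_length.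
        replace (n - N (J n))%Z with (m (J n) - 1)%Z by lia.
        rewrite minus_IZR. ring. }
      assert (Epos' : pos (n + 1)%Z = start G (J n + 1) + fst (p (J n + 1)%Z)).
      { unfold pos. rewrite E, H1', Z.sub_diag. ring. }
      unfold s. rewrite Epos, Epos', E.
      assert (H2 := Hpos n). rewrite Epos in H2.
      assert (H3 := Hpos (n + 1)%Z). rewrite Epos', E in H3.
      destruct Ha as [_ Hx]. fold x in Hx.
      apply billiard_node_crossing; try lra.
      rewrite L2. unfold exit_cos, node_ratio. fold x.
      assert (R1 := radius_pos G (J n)). assert (R2 := radius_pos G (J n + 1)%Z).
      rewrite Rsqr_sqrt by (apply Rlt_le, Rdiv_lt_0_compat; assumption).
      field. lra.
  - intros n. unfold sliding_at, s; simpl fst. rewrite !z_reduce.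
    exists (J n). split; [exists (pos n); auto |].
    assert (H := Hpos (n + 1)%Z).
    destruct (Hstep n) as [[E _] | [E _]]; rewrite E in H; [left | right];
      exists (pos (n + 1)%Z); auto.
  - intros n. destruct (Hp (J n)) as [Ha _].
    apply (admissible_angle _ _ _ _ (Hs (J n)) Ha).
Qed.

(** * Prescribing the angles *)

Lemma periodic_shift (f : Z -> R) (n : Z) :
  (forall j, f (j + n)%Z = f j) -> forall q j, f (j + n * q)%Z = f j.
Proof.
  intros Hf. apply (Z.peano_ind (fun q => forall j, f (j + n * q)%Z = f j)).
  - intros j. f_equal. lia.
  - intros q IH j. rewrite <- (IH j), <- (Hf (j + n * q)%Z). f_equal. lia.
  - intros q IH j. rewrite <- (IH j), <- (Hf (j + n * Z.pred q)%Z). f_equal. lia.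
Qed.

Lemma periodic_lower_bound (f : Z -> R) (n : Z) :
  (0 < n)%Z -> (forall j, f (j + n)%Z = f j) -> (forall j, 0 < f j) ->
  exists c, 0 < c /\ forall j, c <= f j.
Proof.
  intros Hn Hper Hpos.
  assert (H : forall k : nat, exists c, 0 < c /\
    forall j, (0 <= j < Z.of_nat k)%Z -> c <= f j).
  { induction k as [| k (c & Hc & Hk)].
    - exists 1. split; [lra | intros; lia].
    - exists (Rmin c (f (Z.of_nat k))). split; [apply Rmin_pos; auto |].
      intros j Hj. destruct (Z.eq_dec j (Z.of_nat k)) as [-> | Hne].
      + apply Rmin_r.
      + eapply Rle_trans; [apply Rmin_l | apply Hk; lia]. }
  destruct (H (Z.to_nat n)) as (c & Hc & Hk). exists c. split; [exact Hc |].
  intros j. rewrite (Z.div_mod j n) by lia. rewrite Z.add_comm.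
  rewrite (periodic_shift f n Hper). apply Hk.
  rewrite Z2Nat.id by lia. apply Z.mod_pos_bound. lia.
Qed.

Lemma periodic_bounds (f : Z -> R) (n : Z) :
  (0 < n)%Z -> (forall j, f (j + n)%Z = f j) -> (forall j, 0 < f j) ->
  exists D, 1 <= D /\ forall j, / D <= f j <= D.
Proof.
  intros Hn Hper Hpos.
  destruct (periodic_lower_bound f n Hn Hper Hpos) as (c & Hc & Hlow).
  destruct (periodic_lower_bound (fun j => / f j) n Hn) as (c' & Hc' & Hup).
  { intros j. rewrite Hper. reflexivity. }
  { intros j. apply Rinv_0_lt_compat, Hpos. }
  set (D := Rmax 1 (Rmax (/ c) (/ c'))).
  assert (D1 : 1 <= D) by apply Rmax_l.
  assert (D2 : / c <= D) by (eapply Rle_trans; [apply Rmax_l | apply Rmax_r]).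
  assert (D3 : / c' <= D) by (eapply Rle_trans; [apply Rmax_r | apply Rmax_r]).
  exists D. split; [exact D1 |]. intros j. split.
  - apply Rle_trans with c; [| apply Hlow].
    rewrite <- (Rinv_inv c). apply Rinv_le_contravar; [apply Rinv_0_lt_compat, Hc | exact D2].
  - apply Rle_trans with (/ c'); [| exact D3].
    rewrite <- (Rinv_inv (f j)). apply Rinv_le_contravar; auto.
Qed.

(* [node_ratio G j] is [(rho G j / rho G (j + 1))^2], so the growth
   [rho G (j + 1) / rho G j] of the impact numbers is halfway, on a logarithmic
   scale, in the range allowed at the node. *)
Definition rho (G : circular_polygon) (j : Z) : R := sqrt (sqrt (radius G j)).

Lemma rho_pos (G : circular_polygon) (j : Z) : 0 < rho G j.
Proof. apply sqrt_lt_R0, sqrt_lt_R0, radius_pos. Qed.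

Lemma node_ratio_rho (G : circular_polygon) (j : Z) :
  node_ratio G j = (rho G j)² / (rho G (j + 1))².
Proof.
  unfold node_ratio, rho. rewrite !Rsqr_sqrt by apply sqrt_pos.
  rewrite sqrt_div_alt; [reflexivity | apply radius_pos].
Qed.

Lemma arc_length_pos (G : circular_polygon) (j : Z) : 0 < arc_length G j.
Proof. unfold arc_length. assert (H := start_incr G j). lra. Qed.

Lemma polygon_bounds (G : circular_polygon) :
  exists D lam, 1 <= D /\ 1 < lam <= 2 /\ forall j,
    / D <= arc_length G j <= D /\ / D <= rho G j <= D /\
    (lam * lam * rho G j <= rho G (j + 1) \/ lam * lam * rho G (j + 1) <= rho G j).
Proof.
  assert (Hn : (0 < nsides G)%Z) by (assert (H := nsides_gt1 G); lia).
  assert (Hrho : forall j, rho G (j + nsides G) = rho G j)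
    by (intros j; unfold rho; rewrite radius_mod; reflexivity).
  destruct (periodic_bounds (arc_length G) _ Hn) as (D1 & HD1 & H1).
  { intros j. unfold arc_length.
    replace (j + nsides G + 1)%Z with (j + 1 + nsides G)%Z by lia.
    rewrite !start_mod. ring. }
  { apply arc_length_pos. }
  destruct (periodic_bounds (rho G) _ Hn Hrho (rho_pos G)) as (D2 & HD2 & H2).
  destruct (periodic_lower_bound (fun j => Rmax (rho G (j + 1) / rho G j)
    (rho G j / rho G (j + 1)) - 1) _ Hn) as (c & Hc & H3).
  { intros j. replace (j + nsides G + 1)%Z with (j + 1 + nsides G)%Z by lia.
    rewrite !Hrho. reflexivity. }
  { intros j. assert (P := rho_pos G j). assert (P' := rho_pos G (j + 1)).
    assert (Hne : rho G j <> rho G (j + 1)).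
    { intros E. apply (consecutive_radii G j).
      assert (R := radius_pos G j). assert (R' := radius_pos G (j + 1)).
      apply sqrt_inj; try lra. apply sqrt_inj; [apply sqrt_pos .. | exact E]. }
    apply Rlt_0_minus.
    destruct (Rtotal_order (rho G j) (rho G (j + 1))) as [H | [H | H]]; [| tauto |].
    - eapply Rlt_le_trans; [| apply Rmax_l].
      apply (Rmult_lt_reg_r (rho G j)); [exact P |]. field_simplify; lra.
    - eapply Rlt_le_trans; [| apply Rmax_r].
      apply (Rmult_lt_reg_r (rho G (j + 1))); [exact P' |]. field_simplify; lra. }
  assert (HDD : forall D D' x, 1 <= D -> D <= D' -> / D <= x <= D -> / D' <= x <= D').
  { intros D D' x HD HD' Hx. split; [| lra].
    apply Rle_trans with (/ D); [apply Rinv_le_contravar |]; lra. }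
  (* As [e <= 1], [(1 + e)^2 <= 1 + 3 e <= 1 + c]: the square of [lam = 1 + e] is below every ratio
     of consecutive values of [rho], larger over smaller. *)
  set (e := Rmin 1 c / 3).
  assert (He : 0 < e <= 1 / 3 /\ 3 * e <= c).
  { unfold e, Rmin; destruct (Rle_dec 1 c); lra. }
  exists (Rmax D1 D2), (1 + e).
  split; [apply Rle_trans with D1; [exact HD1 | apply Rmax_l] |].
  split; [lra |]. intros j.
  split; [apply HDD with D1; auto using Rmax_l |].
  split; [apply HDD with D2; auto using Rmax_r |].
  assert (Hl : (1 + e) * (1 + e) <= 1 + c) by nra.
  assert (P := rho_pos G j). assert (P' := rho_pos G (j + 1)).
  specialize (H3 j). simpl in H3. revert H3. unfold Rmax.
  destruct (Rle_dec (rho G (j + 1) / rho G j) (rho G j / rho G (j + 1))); intros H3;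
    [right | left].
  - apply Rle_trans with ((rho G j / rho G (j + 1)) * rho G (j + 1)).
    + apply Rmult_le_compat_r; lra.
    + right. field. lra.
  - apply Rle_trans with ((rho G (j + 1) / rho G j) * rho G j).
    + apply Rmult_le_compat_r; lra.
    + right. field. lra.
Qed.

(** [E] is the scale of the level, and [m] is [d * rho * E] up to rounding. The lower bound on
    [(lam - 1) * E] absorbs the rounding and the error terms of [jump]. *)
Definition scaled_level (D lam E d rho m : R) : Prop :=
  / D <= d <= D /\ / D <= rho <= D /\ 8 * D ^ 8 <= (lam - 1) * E /\
  d * rho * E - 1 <= m <= d * rho * E.

Lemma level_size (D lam E d rho m : R) :
  1 <= D -> 1 < lam <= 2 -> scaled_level D lam E d rho m ->
  0 < d /\ 0 < rho /\ 0 < E /\ 8 * D ^ 6 <= d * rho * E.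
Proof.
  intros HD Hl (Hd & Hr & HE & _).
  assert (HDi : 0 < / D) by (apply Rinv_0_lt_compat; lra).
  assert (HD8 : 0 < D ^ 8) by (apply pow_lt; lra).
  assert (0 < E) by nra.
  assert (8 * D ^ 8 <= E) by nra.
  repeat split; try lra.
  apply Rle_trans with (/ D * / D * (8 * D ^ 8)).
  - right. field. lra.
  - apply Rmult_le_compat; [nra | lra | | assumption].
    apply Rmult_le_compat; lra.
Qed.

Lemma level_small_angles (D lam E d rho m mu : R) :
  1 <= D -> 1 < lam <= 2 -> scaled_level D lam E d rho m ->
  0 < mu <= D ^ 4 -> small_angles d m mu.
Proof.
  intros HD Hl Hlev Hmu.
  destruct (level_size _ _ _ _ _ _ HD Hl Hlev) as (Hd0 & _ & _ & H6).
  destruct Hlev as (Hd & _ & _ & Hm).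
  assert (P4 : 1 <= D ^ 4) by (apply pow_R1_Rle; exact HD).
  assert (P5 : D <= D ^ 5) by (simpl in *; nra).
  assert (P6 : D ^ 5 <= D ^ 6) by (simpl in *; nra).
  assert (mu * d <= D ^ 4 * D) by (apply Rmult_le_compat; lra).
  replace (D ^ 4 * D) with (D ^ 5) in * by ring.
  unfold small_angles. repeat split; lra.
Qed.

(** [d] is about [2 m t] and [m] about [d rho E], hence [t E] is about [1 / (2 rho)]. *)
Lemma level_angle (D lam E d rho m t : R) :
  1 <= D -> 1 < lam <= 2 -> scaled_level D lam E d rho m ->
  2 * (m - 1) * t <= d <= 2 * (m + 1) * t ->
  / (4 * D ^ 3) <= t * E <= D.
Proof.
  intros HD Hl Hlev Ht.
  destruct (level_size _ _ _ _ _ _ HD Hl Hlev) as (Hd0 & Hr0 & HE & H6).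
  destruct Hlev as (Hd & Hr & _ & Hm).
  assert (P6 : 1 <= D ^ 6) by (apply pow_R1_Rle; exact HD).
  assert (P3 : 0 < D ^ 3) by (apply pow_lt; lra).
  assert (Ht0 : 0 < t) by nra.
  set (w := d * rho * E) in *.
  split.
  - assert (H1 : d <= 4 * w * t) by nra.
    assert (H2 : 1 <= 4 * (rho * (t * E))).
    { apply (Rmult_le_reg_l d); [exact Hd0 |]. unfold w in H1. lra. }
    assert (H3 : rho * (t * E) <= D * (t * E)) by (apply Rmult_le_compat_r; nra).
    apply (Rmult_le_reg_l (4 * D ^ 3)); [lra |].
    rewrite Rinv_r by lra.
    assert (D <= D ^ 3) by (simpl; nra).
    assert (D * (t * E) <= D ^ 3 * (t * E)) by (apply Rmult_le_compat_r; nra).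
    lra.
  - assert (H1 : w * t <= d) by nra.
    assert (H2 : rho * (t * E) <= 1).
    { apply (Rmult_le_reg_l d); [exact Hd0 |]. unfold w in H1. lra. }
    assert (H3 : / D * (t * E) <= rho * (t * E)) by (apply Rmult_le_compat_r; nra).
    apply (Rmult_le_reg_l (/ D)); [apply Rinv_0_lt_compat; lra |].
    rewrite Rinv_l by lra. lra.
Qed.

(** To leading order the two inequalities of [jump] compare [rho E] with [rho' E'] and [rho E'] with
    [rho' E]. A change of scale costs one factor [lam] of the gap [lam * lam]; the other factor
    leaves a margin proportional to [lam - 1]. *)
Lemma level_jump (D lam E d rho m E' d' rho' m' : R) :
  1 <= D -> 1 < lam <= 2 ->
  scaled_level D lam E d rho m -> scaled_level D lam E' d' rho' m' ->
  E' <= lam * E -> E <= lam * E' ->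
  lam * lam * rho <= rho' \/ lam * lam * rho' <= rho ->
  jump d m (rho² / rho'²) d' m'.
Proof.
  intros HD Hl Hlev Hlev' HE1 HE2 Hgap.
  destruct (level_size _ _ _ _ _ _ HD Hl Hlev) as (Hd0 & Hr0 & HE0 & _).
  destruct (level_size _ _ _ _ _ _ HD Hl Hlev') as (Hd0' & Hr0' & HE0' & _).
  destruct Hlev as (Hd & Hr & HE & Hm). destruct Hlev' as (Hd' & Hr' & HE' & Hm').
  assert (HDi : 0 < / D) by (apply Rinv_0_lt_compat; lra).
  assert (P3 : 0 < D ^ 3) by (apply pow_lt; lra).
  assert (P31 : D <= D ^ 3) by (simpl; nra).
  assert (P53 : D ^ 3 <= D ^ 5) by (simpl; nra).
  assert (Hsq : rho * rho * d <= D ^ 3).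
  { replace (D ^ 3) with (D * D * D) by ring.
    apply Rmult_le_compat; try nra. }
  assert (Hsq' : rho' * rho' * d' <= D ^ 3).
  { replace (D ^ 3) with (D * D * D) by ring.
    apply Rmult_le_compat; try nra. }
  (* The margins [8 D^5] and [8 D^3] exceed the error terms, which are at most [2 D] and [5 D^3] in
     the respective inequalities. *)
  assert (Hprod3 : forall x y z e, / D <= x -> / D <= y -> / D <= z ->
    8 * D ^ 8 <= e -> 8 * D ^ 5 <= x * y * z * e).
  { intros x y z e Hx Hy Hz He.
    apply Rle_trans with (/ D * / D * / D * (8 * D ^ 8)); [right; field; lra |].
    assert (0 < / D * / D) by nra. assert (0 < / D * / D * / D) by nra.
    assert (0 < D ^ 8) by (apply pow_lt; lra).
    repeat apply Rmult_le_compat; lra. }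
  assert (Hprod5 : forall x y z v w e, / D <= x -> / D <= y -> / D <= z ->
    / D <= v -> / D <= w ->
    8 * D ^ 8 <= e -> 8 * D ^ 3 <= x * y * z * v * w * e).
  { intros x y z v w e Hx Hy Hz Hv Hw He.
    apply Rle_trans with (/ D * / D * / D * / D * / D * (8 * D ^ 8)); [right; field; lra |].
    assert (0 < / D * / D) by nra. assert (0 < / D * / D * / D) by nra.
    assert (0 < / D * / D * / D * / D) by nra.
    assert (0 < / D * / D * / D * / D * / D) by nra.
    assert (0 < D ^ 8) by (apply pow_lt; lra).
    repeat apply Rmult_le_compat; lra. }
  assert (Hsq0 : 0 < rho² /\ 0 < rho'²) by (split; apply Rsqr_pos_lt; lra).
  assert (Hmu : forall x y, x * rho² <= y * rho'² -> x * (rho² / rho'²) <= y).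
  { intros x y H. apply (Rmult_le_reg_r (rho'²)); [lra |].
    replace (x * (rho² / rho'²) * rho'²) with (x * rho²) by (field; lra). exact H. }
  assert (Hmu' : forall x y, y * rho'² <= x * rho² -> y <= x * (rho² / rho'²)).
  { intros x y H. apply (Rmult_le_reg_r (rho'²)); [lra |].
    replace (x * (rho² / rho'²) * rho'²) with (x * rho²) by (field; lra). exact H. }
  assert (Hdd : 0 < d * d') by nra.
  assert (Hrr : 0 < rho * rho') by nra.
  destruct Hgap as [Hgap | Hgap]; [left | right].
  - assert (G1 : lam * (rho * E) <= rho' * E').
    { apply Rle_trans with (lam * rho * (lam * E')); [| nra].
      replace (lam * (rho * E)) with (lam * rho * E) by ring.
      apply Rmult_le_compat_l; nra. }
    assert (G2 : lam * (rho * E') <= rho' * E).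
    { apply Rle_trans with (lam * rho * (lam * E)); [| nra].
      replace (lam * (rho * E')) with (lam * rho * E') by ring.
      apply Rmult_le_compat_l; nra. }
    split; [| split].
    + rewrite <- (Rmult_1_l (rho² / rho'²)). apply Hmu. rewrite !Rmult_1_l.
      apply Rsqr_incr_1; nra.
    + assert (K := Hprod3 d d' rho _ (proj1 Hd) (proj1 Hd') (proj1 Hr) HE).
      assert (K' : d * d' * rho * ((lam - 1) * E) <= d * d' * (rho' * E' - rho * E)).
      { replace (d * d' * rho * ((lam - 1) * E))
          with (d * d' * (lam * (rho * E) - rho * E)) by ring.
        apply Rmult_le_compat_l; lra. }
      assert ((m + 1) * d' <= (d * rho * E + 1) * d') by (apply Rmult_le_compat_r; lra).
      assert ((d' * rho' * E' - 1) * d <= m' * d) by (apply Rmult_le_compat_r; lra).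
      lra.
    + replace ((2 * m' + 1) * (rho² / rho'² * d))
        with (((2 * m' + 1) * d) * (rho² / rho'²)) by ring.
      apply Hmu. unfold Rsqr.
      assert (K := Hprod5 d d' rho rho rho' _ (proj1 Hd) (proj1 Hd') (proj1 Hr)
        (proj1 Hr) (proj1 Hr') HE').
      assert (K' : d * d' * rho * rho * rho' * ((lam - 1) * E') <=
        d * d' * (rho * rho') * (rho' * E - rho * E')).
      { replace (d * d' * rho * rho * rho' * ((lam - 1) * E'))
          with (d * d' * (rho * rho') * (lam * (rho * E') - rho * E')) by ring.
        apply Rmult_le_compat_l; [nra | lra]. }
      assert ((2 * m' + 1) * (d * (rho * rho)) <=
        (2 * (d' * rho' * E') + 1) * (d * (rho * rho)))
        by (apply Rmult_le_compat_r; nra).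
      assert (2 * (d * rho * E - 2) * (d' * (rho' * rho')) <=
        2 * (m - 1) * (d' * (rho' * rho')))
        by (apply Rmult_le_compat_r; nra).
      lra.
  - assert (G1 : lam * (rho' * E') <= rho * E).
    { apply Rle_trans with (lam * rho' * (lam * E)); [| nra].
      replace (lam * (rho' * E')) with (lam * rho' * E') by ring.
      apply Rmult_le_compat_l; nra. }
    assert (G2 : lam * (rho' * E) <= rho * E').
    { apply Rle_trans with (lam * rho' * (lam * E')); [| nra].
      replace (lam * (rho' * E)) with (lam * rho' * E) by ring.
      apply Rmult_le_compat_l; nra. }
    split; [| split].
    + rewrite <- (Rmult_1_l (rho² / rho'²)). apply Hmu'. rewrite !Rmult_1_l.
      apply Rsqr_incr_1; nra.
    + assert (K := Hprod3 d d' rho' _ (proj1 Hd) (proj1 Hd') (proj1 Hr') HE').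
      assert (K' : d * d' * rho' * ((lam - 1) * E') <= d * d' * (rho * E - rho' * E')).
      { replace (d * d' * rho' * ((lam - 1) * E'))
          with (d * d' * (lam * (rho' * E') - rho' * E')) by ring.
        apply Rmult_le_compat_l; lra. }
      assert ((d * rho * E - 2) * d' <= (m - 1) * d') by (apply Rmult_le_compat_r; lra).
      assert (m' * d <= (d' * rho' * E') * d) by (apply Rmult_le_compat_r; lra).
      lra.
    + replace ((2 * m' - 1) * (rho² / rho'² * d))
        with (((2 * m' - 1) * d) * (rho² / rho'²)) by ring.
      apply Hmu'. unfold Rsqr.
      assert (K := Hprod5 d d' rho rho' rho' _ (proj1 Hd) (proj1 Hd') (proj1 Hr)
        (proj1 Hr') (proj1 Hr') HE).
      assert (K' : d * d' * rho * rho' * rho' * ((lam - 1) * E) <=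
        d * d' * (rho * rho') * (rho * E' - rho' * E)).
      { replace (d * d' * rho * rho' * rho' * ((lam - 1) * E))
          with (d * d' * (rho * rho') * (lam * (rho' * E) - rho' * E)) by ring.
        apply Rmult_le_compat_l; [nra | lra]. }
      assert ((2 * (d' * rho' * E') - 3) * (d * (rho * rho)) <=
        (2 * m' - 1) * (d * (rho * rho)))
        by (apply Rmult_le_compat_r; nra).
      assert (2 * (m + 1) * (d' * (rho' * rho')) <=
        2 * (d * rho * E + 1) * (d' * (rho' * rho')))
        by (apply Rmult_le_compat_r; nra).
      lra.
Qed.

Lemma sliding_levels (G : circular_polygon) :
  exists lam a b, 1 < lam /\ 0 < a /\ forall L : Z -> nat,
    (forall j, (L (j + 1)%Z <= L j + 1)%nat /\ (L j <= L (j + 1)%Z + 1)%nat) ->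
    exists (s : Z -> R * R) (J : Z -> Z),
      J 0%Z = 0%Z /\
      (forall n, (J n <= J (n + 1) <= J n + 1)%Z) /\
      (forall j, exists n, J n = j) /\
      (forall n, billiard G (s n) (s (n + 1)%Z)) /\
      (forall n, sliding_at G lam_0 s n) /\
      (forall n, a <= snd (s n) * lam ^ L (J n) <= b).
Proof.
  destruct (polygon_bounds G) as (D & lam & HD & Hlam & HG).
  (* This scale meets the size condition with equality at level 0, hence all levels meet it. *)
  set (E0 := 8 * D ^ 8 / (lam - 1)).
  assert (P8 : 1 <= D ^ 8) by (apply pow_R1_Rle; exact HD).
  assert (P3 : 0 < D ^ 3) by (apply pow_lt; lra).
  assert (HE0 : 0 < E0) by (apply Rdiv_lt_0_compat; lra).
  exists lam, (/ (4 * D ^ 3) / E0), (D / E0). split; [lra |].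
  split; [apply Rdiv_lt_0_compat; [apply Rinv_0_lt_compat; lra | exact HE0] |].
  intros L HL.
  set (E := fun j => E0 * lam ^ L j).
  set (m := fun j => Zfloor (arc_length G j * rho G j * E j)).
  assert (Hlev : forall j, scaled_level D lam (E j) (arc_length G j) (rho G j) (IZR (m j))).
  { intros j. destruct (HG j) as (H1 & H2 & _).
    split; [exact H1 |]. split; [exact H2 |]. split.
    - assert (1 <= lam ^ L j) by (apply pow_R1_Rle; lra).
      assert (E0 <= E j) by (unfold E; nra).
      apply Rle_trans with ((lam - 1) * E0); [right; unfold E0; field; lra |].
      apply Rmult_le_compat_l; lra.
    - unfold m. destruct (Zfloor_bound (arc_length G j * rho G j * E j)). lra. }
  assert (HEL : forall i j, (L i <= L j + 1)%nat -> E i <= lam * E j).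
  { intros i j Hij. unfold E. replace (lam * (E0 * lam ^ L j)) with (E0 * lam ^ S (L j))
      by (simpl; ring).
    apply Rmult_le_compat_l; [lra |]. apply Rle_pow; [lra | lia]. }
  destruct (sliding_trajectory G m) as (s & J & H0 & H1 & H2 & H3 & H4 & H5).
  - intros j. apply (level_small_angles D lam (E j) _ (rho G j)); auto.
    rewrite node_ratio_rho.
    destruct (HG j) as (_ & Hr & _). destruct (HG (j + 1)%Z) as (_ & Hr' & _).
    assert (Pr := rho_pos G j). assert (Pr' := rho_pos G (j + 1)).
    split; [apply Rdiv_lt_0_compat; apply Rsqr_pos_lt; lra |].
    replace (D ^ 4) with (D² * (/ / D)²) by (unfold Rsqr; field; lra).
    assert (HDi : 0 < / D) by (apply Rinv_0_lt_compat; lra).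
    unfold Rdiv. replace (/ (rho G (j + 1))²) with ((/ rho G (j + 1))²)
      by (unfold Rsqr; field; lra).
    apply Rmult_le_compat; [apply Rle_0_sqr .. | |].
    + apply Rsqr_incr_1; lra.
    + apply Rsqr_incr_1; [apply Rinv_le_contravar; lra | |];
        apply Rlt_le, Rinv_0_lt_compat; lra.
  - intros j. rewrite node_ratio_rho.
    apply (level_jump D lam (E j) _ _ _ (E (j + 1)%Z)); auto.
    + apply HEL, HL.
    + apply HEL, HL.
    + apply HG.
  - exists s, J. repeat (split; [assumption |]). intros n.
    assert (H := level_angle _ _ _ _ _ _ _ HD Hlam (Hlev (J n)) (H5 n)).
    unfold E in H.
    replace (snd (s n) * (E0 * lam ^ L (J n)))
      with (snd (s n) * lam ^ L (J n) * E0) in H by ring.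
    assert (Hdiv : forall w, w / E0 * E0 = w) by (intros w; field; lra).
    split; apply (Rmult_le_reg_r E0); try assumption; rewrite Hdiv; lra.
Qed.

(** * Profiles of the three final motions *)

Definition profile (X : final_motion) (k : nat) : nat :=
  match X with
  | Bounded => 0
  | Asymptotic => k
  (* A zigzag: [s] at [k = s^2], [0] at [k = s (s + 1)]. *)
  | Oscillatory => let s := Nat.sqrt k in (k - s * (s + 1)) + (s * (s + 1) - k)
  end.

Lemma profile_0 (X : final_motion) : profile X 0 = 0%nat.
Proof. destruct X; reflexivity. Qed.

(** In the zigzag, the sum of truncated differences is [|k - s (s + 1)|]. It moves by one while the
    root [s] is constant; when the root increases, it goes from [s] at [k = s^2 + 2 s] to
    [s + 1]. *)
Lemma profile_lipschitz (X : final_motion) (k : nat) :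
  (profile X (S k) <= profile X k + 1)%nat /\ (profile X k <= profile X (S k) + 1)%nat.
Proof.
  destruct X; unfold profile; try lia; cbv zeta.
  assert (H := Nat.sqrt_spec k (Nat.le_0_l _)).
  assert (H' := Nat.sqrt_spec (S k) (Nat.le_0_l _)).
  revert H H'. generalize (Nat.sqrt k) (Nat.sqrt (S k)). intros s s' H H'.
  assert (Hs : (s <= s' <= S s)%nat) by (split; nia).
  destruct (Nat.eq_dec s' s) as [-> | Hne]; [lia |].
  assert (s' = S s) as -> by lia. nia.
Qed.

Lemma profile_square (s : nat) : profile Oscillatory (s * s) = s.
Proof. simpl. rewrite Nat.sqrt_square. nia. Qed.

Lemma profile_pronic (s : nat) : profile Oscillatory (s * (s + 1)) = 0%nat.
Proof.
  simpl. assert (Nat.sqrt (s * (s + 1)) = s) as ->; [| lia].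
  apply Nat.sqrt_unique. nia.
Qed.

Lemma pow_unbounded (lam x : R) : 1 < lam -> exists k : nat, x < lam ^ k.
Proof.
  intros Hl. destruct (Pow_x_infinity lam) with (b := x + 1) as [N HN].
  { rewrite Rabs_pos_eq; lra. }
  exists N. specialize (HN N (Nat.le_refl N)).
  rewrite Rabs_pos_eq in HN by (apply pow_le; lra). lra.
Qed.

(** [u] is comparable to [lam] to the power minus the profile, and [K] takes every large value
    arbitrarily late. In the oscillatory case the squares give terms tending to 0 and the pronic
    numbers give terms at least [a]. *)
Lemma motion_of_profile (X : final_motion) (lam a b : R) (K : nat -> nat) (k0 : nat)
    (u : nat -> R) :
  1 < lam -> 0 < a ->
  (forall n, (K n <= K (S n))%nat) ->
  (forall k, (k0 <= k)%nat -> exists n, K n = k) ->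
  (forall n, a <= u n * lam ^ profile X (K n) <= b) ->
  has_motion X u.
Proof.
  intros Hl Ha HK Hsurj Hu.
  assert (Hmono : forall n n', (n <= n')%nat -> (K n <= K n')%nat).
  { intros n n' H. induction H as [| n' H IH]; [lia |]. specialize (HK n'). lia. }
  assert (Hlate : forall N k, (K N + k0 < k)%nat -> exists n, (N <= n)%nat /\ K n = k).
  { intros N k Hk. destruct (Hsurj k) as [n Hn]; [lia |]. exists n. split; [| exact Hn].
    destruct (Nat.le_gt_cases N n) as [H | H]; [exact H |].
    assert (H' := Hmono n N). lia. }
  assert (Hpow : forall k, 0 < lam ^ k) by (intros k; apply pow_lt; lra).
  assert (Hpos : forall n, 0 < u n).
  { intros n. specialize (Hpow (profile X (K n))). specialize (Hu n). nra. }
  assert (Hsmall : forall e, 0 < e -> exists k1, forall n,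
    (k1 <= profile X (K n))%nat -> u n < e).
  { intros e He. destruct (pow_unbounded lam (b / e) Hl) as [k1 Hk1].
    exists k1. intros n Hn.
    assert (lam ^ k1 <= lam ^ profile X (K n)) by (apply Rle_pow; [lra | exact Hn]).
    specialize (Hu n). specialize (Hpos n).
    apply (Rmult_lt_reg_r (lam ^ profile X (K n))); [apply Hpow |].
    apply Rle_lt_trans with b; [apply Hu |].
    replace b with (e * (b / e)) by (field; lra).
    apply Rmult_lt_compat_l; lra. }
  destruct X; unfold has_motion.
  - apply Rbar_lt_le_trans with (Inf_seq (fun _ => Finite a)).
    + replace (Inf_seq (fun _ => Finite a)) with (Finite a); [exact Ha |].
      symmetry. apply is_inf_seq_unique. intros e.
      assert (H := cond_pos e). split; [intros n; simpl; lra | exists 0%nat; simpl; lra].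
    + apply Inf_seq_le. intros n. simpl. specialize (Hu n). simpl in Hu. lra.
  - split.
    + apply is_LimInf_seq_unique. intros e. split.
      * intros N. destruct (Hsmall e (cond_pos e)) as [k1 Hk1].
        set (q := (k1 + K N + k0 + 1)%nat).
        destruct (Hlate N (q * q)%nat) as (n & Hn & E); [nia |].
        exists n. split; [exact Hn |]. rewrite Rplus_0_l. apply Hk1.
        rewrite E, profile_square. lia.
      * exists 0%nat. intros n _. specialize (Hpos n). assert (H := cond_pos e). lra.
    + assert (Hio : forall N, exists n, (N <= n)%nat /\ a <= u n).
      { intros N. set (q := (K N + k0 + 1)%nat).
        destruct (Hlate N (q * (q + 1))%nat) as (n & Hn & E); [nia |].
        exists n. split; [exact Hn |]. specialize (Hu n).
        rewrite E, profile_pronic in Hu. simpl in Hu. lra. }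
      unfold LimSup_seq. destruct (ex_LimSup_seq u) as [l Hlim]. simpl.
      destruct l as [l | |]; simpl; [| exact I |].
      * destruct (Rlt_le_dec 0 l) as [H | H]; [exact H |]. exfalso.
        destruct (Hlim (mkposreal a Ha)) as [_ [N HN]].
        destruct (Hio N) as (n & Hn & Hn'). specialize (HN n Hn). simpl in HN. lra.
      * destruct (Hlim 0) as [N HN]. specialize (HN N (Nat.le_refl N)).
        specialize (Hpos N). lra.
  - apply is_lim_seq_spec. intros e. destruct (Hsmall e (cond_pos e)) as [k1 Hk1].
    destruct (Hsurj (k0 + k1)%nat) as [N HN]; [lia |].
    exists N. intros n Hn. rewrite Rminus_0_r, Rabs_pos_eq by apply Rlt_le, Hpos.
    apply Hk1. simpl. specialize (Hmono N n Hn). lia.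
Qed.

(** The levels follow the profile of [Y] over the arcs [j >= 0] and that of [X] over [j < 0]; both
    vanish at 0, so the junction is 1-Lipschitz. The offset [c] serves the two starting times 0 and
    -1, in either direction of time. *)
Lemma ccw_sliding_motions (G : circular_polygon) (X Y : final_motion) :
  exists s : Z -> R * R,
    (forall n, billiard G (s n) (s (n + 1)%Z)) /\
    (forall n, sliding_at G lam_0 s n) /\
    (forall c : nat, has_motion Y (fun m => snd (s (Z.of_nat c + Z.of_nat m)%Z))) /\
    (forall c : nat, has_motion X (fun m => snd (s (- Z.of_nat c - Z.of_nat m)%Z))).
Proof.
  destruct (sliding_levels G) as (lam & a & b & Hl & Ha & H).
  set (L := fun j => if Z_le_dec 0 j then profile Y (Z.to_nat j)
    else profile X (Z.to_nat (- j))).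
  destruct (H L) as (s & J & J0 & Hstep & Hsurj & Hb & Hs & Hang).
  { intros j. unfold L.
    destruct (Z_le_dec 0 (j + 1)) as [H1 | H1], (Z_le_dec 0 j) as [H2 | H2]; try lia.
    - replace (Z.to_nat (j + 1)) with (S (Z.to_nat j)) by lia. apply profile_lipschitz.
    - replace j with (-1)%Z by lia. simpl. rewrite profile_0.
      change (Pos.to_nat 1) with 1%nat.
      assert (P := profile_lipschitz X 0). rewrite profile_0 in P. lia.
    - replace (Z.to_nat (- j)) with (S (Z.to_nat (- (j + 1)))) by lia.
      split; apply profile_lipschitz. }
  assert (Hmono : forall n n', (n <= n')%Z -> (J n <= J n')%Z).
  { intros n n' Hn. replace n' with (n + Z.of_nat (Z.to_nat (n' - n)))%Z by lia.
    induction (Z.to_nat (n' - n)) as [| k IH]; [rewrite Z.add_0_r; lia |].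
    replace (n + Z.of_nat (S k))%Z with (n + Z.of_nat k + 1)%Z by lia.
    specialize (Hstep (n + Z.of_nat k)%Z). lia. }
  exists s. split; [exact Hb |]. split; [exact Hs |]. split; intros c.
  - assert (Hge : forall m : nat, (0 <= J (Z.of_nat c + Z.of_nat m))%Z).
    { intros m. rewrite <- J0. apply Hmono. lia. }
    (* By monotonicity of [J], an arc strictly beyond that of impact [c] is reached only after time
       [c]; hence the threshold with [+ 1]. *)
    apply (motion_of_profile Y lam a b
      (fun m => Z.to_nat (J (Z.of_nat c + Z.of_nat m)%Z))
      (Z.to_nat (J (Z.of_nat c)) + 1)); auto.
    + intros n. assert (H1 := Hmono (Z.of_nat c + Z.of_nat n)%Z
        (Z.of_nat c + Z.of_nat (S n))%Z).
      lia.
    + intros k Hk. destruct (Hsurj (Z.of_nat k)) as [n Hn].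
      assert (Hcn : (Z.of_nat c <= n)%Z).
      { destruct (Z_le_gt_dec (Z.of_nat c) n) as [H1 | H1]; [exact H1 |].
        assert (H2 := Hmono n (Z.of_nat c)). lia. }
      exists (Z.to_nat (n - Z.of_nat c)).
      replace (Z.of_nat c + Z.of_nat (Z.to_nat (n - Z.of_nat c)))%Z with n by lia. lia.
    + intros n. specialize (Hang (Z.of_nat c + Z.of_nat n)%Z). specialize (Hge n).
      unfold L in Hang. destruct (Z_le_dec 0 _) as [H1 | H1]; [exact Hang | lia].
  - assert (Hge : forall m : nat, (J (- Z.of_nat c - Z.of_nat m) <= 0)%Z).
    { intros m. rewrite <- J0. apply Hmono. lia. }
    apply (motion_of_profile X lam a b
      (fun m => Z.to_nat (- J (- Z.of_nat c - Z.of_nat m)%Z))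
      (Z.to_nat (- J (- Z.of_nat c)%Z) + 1)); auto.
    + intros n. assert (H1 := Hmono (- Z.of_nat c - Z.of_nat (S n))%Z
        (- Z.of_nat c - Z.of_nat n)%Z).
      lia.
    + intros k Hk. destruct (Hsurj (- Z.of_nat k)%Z) as [n Hn].
      assert (Hcn : (n <= - Z.of_nat c)%Z).
      { destruct (Z_le_gt_dec n (- Z.of_nat c)) as [H1 | H1]; [exact H1 |].
        assert (H2 := Hmono (- Z.of_nat c)%Z n). lia. }
      exists (Z.to_nat (- Z.of_nat c - n)).
      replace (- Z.of_nat c - Z.of_nat (Z.to_nat (- Z.of_nat c - n)))%Z with n by lia. lia.
    + intros n. specialize (Hang (- Z.of_nat c - Z.of_nat n)%Z). specialize (Hge n).
      unfold L in Hang. destruct (Z_le_dec 0 _) as [H1 | H1]; [| exact Hang].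
      (* In arc 0 the level is read off the profile of [Y], which agrees there with that of [X]. *)
      assert (E : J (- Z.of_nat c - Z.of_nat n)%Z = 0%Z) by lia.
      rewrite E in Hang |- *. simpl in *. rewrite profile_0 in *. exact Hang.
Qed.

(** * Time reversal and conclusion *)

Definition time_reversal (x : R * R) : R * R := (fst x, PI - snd x).

(** The reversed chord has direction [- v], and [cis (PI - w) * cis w = -1] turns the angles at its
    ends into their supplements. *)
Lemma billiard_time_reversal (G : circular_polygon) (x y : R * R) :
  billiard G x y -> billiard G (time_reversal y) (time_reversal x).
Proof.
  destruct x as [a t], y as [a' t']. unfold time_reversal, billiard, phase_point; simpl.
  intros (Hx & Hy & Hne & [c Hc] & Ht).
  set (v := (cis t * tangent a)%C) in *.
  assert (Hpi : forall w, (cis (PI - w) * cis w)%C = RtoC (-1)).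
  { intros w. rewrite <- cis_plus. unfold cis, RtoC.
    replace (PI - w + w) with PI by ring. rewrite cos_PI, sin_PI. reflexivity. }
  assert (Hv : (cis (PI - t') * tangent a')%C = (- v)%C).
  { rewrite Ht, Cmult_assoc, Hpi. unfold RtoC.
    destruct v as [v1 v2]. unfold Cmult, Copp; simpl. f_equal; ring. }
  rewrite Hv.
  split; [lra |]. split; [lra |]. split; [intros E; apply Hne; auto |]. split.
  - exists c. rewrite Hc. ring.
  - transitivity (- (RtoC (-1) * tangent a))%C.
    + destruct (tangent a) as [v1 v2]. unfold RtoC, Cmult, Copp; simpl. f_equal; ring.
    + rewrite <- (Hpi t). unfold v. ring.
Qed.

Lemma sliding_step_reverse (G : circular_polygon) (p q : C) :
  sliding_step G lam_0 p q -> sliding_step G lam_pi q p.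
Proof.
  intros (j & Hp & [Hq | Hq]).
  - exists j. auto.
  - exists (j + 1)%Z. split; [exact Hq |]. right.
    replace (j + 1 - 1)%Z with j by lia. exact Hp.
Qed.

Theorem corollary2 :
  forall (G : circular_polygon) (X Y : final_motion) (l : end_angle),
    exists x : R * R, backward_class G X l x /\ forward_class G Y l x.
Proof.
  intros G X Y l. destruct l.
  - destruct (ccw_sliding_motions G X Y) as (s & Hb & Hs & Hf & Hbk).
    exists (s 0%Z). split; exists s; (split; [split; auto |]); (split; [auto |]).
    + apply (Hbk 1%nat).
    + apply (Hf 0%nat).
  (* The two motions are exchanged, as reversal swaps past and future: the past of [s'] from time -1
     is the future of [s] from time 1. *)
  - destruct (ccw_sliding_motions G Y X) as (s & Hb & Hs & Hf & Hbk).
    set (s' := fun n => time_reversal (s (- n)%Z)).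
    assert (Hb' : forall n, billiard G (s' n) (s' (n + 1)%Z)).
    { intros n. apply billiard_time_reversal.
      replace (- n)%Z with (- (n + 1) + 1)%Z by lia. apply Hb. }
    assert (Hs' : forall n, sliding_at G lam_pi s' n).
    { intros n. apply sliding_step_reverse. unfold s', time_reversal; simpl fst.
      replace (- n)%Z with (- (n + 1) + 1)%Z by lia. apply Hs. }
    assert (Hgap : forall n, angle_gap lam_pi (snd (s' n)) = snd (s (- n)%Z)).
    { intros n. specialize (Hb (- n)%Z). unfold s', billiard, phase_point in *.
      destruct (s (- n)%Z) as [a t], (s (- n + 1)%Z) as [a' t']. simpl in *.
      rewrite Rabs_left; lra. }
    exists (s' 0%Z). split; exists s'; (split; [split; auto |]); (split; [auto |]).
    + replace (fun m : nat => angle_gap lam_pi (snd (s' (-1 - Z.of_nat m)%Z)))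
        with (fun m : nat => snd (s (Z.of_nat 1 + Z.of_nat m)%Z)); [apply Hf |].
      apply functional_extensionality. intros m. rewrite Hgap. do 2 f_equal. lia.
    + replace (fun m : nat => angle_gap lam_pi (snd (s' (Z.of_nat m))))
        with (fun m : nat => snd (s (- Z.of_nat 0 - Z.of_nat m)%Z)); [apply Hbk |].
      apply functional_extensionality. intros m. rewrite Hgap. do 2 f_equal.
Qed.
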